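(* Assume the Vojta conjecture or the Hall--Lang conjecture, in the following form: the height bound $\mathrm{B}(d)$ (defined in the context) holds either for $d\in\{3,4\}$ (Hall--Lang) or for all $d\geq 5$ (Vojta). Let $\gamma,c\in\mathbb{Z}[t]$ and let $\phi(x)=(x-\gamma(t))^2+c(t)$. Suppose that $\phi$ is not isotrivial and that $\phi(\gamma)\cdot\phi^2(\gamma)\neq 0$ in $\mathbb{Z}[t]$. For $a\in\mathbb{Z}$ let $\phi_a(x)=(x-\gamma(a))^2+c(a)\in\mathbb{Z}[x]$. Then there exist an integer $n_\phi>0$ and an effectively computable finite set $F_\phi\subset\mathbb{Z}$ such that for all integers $a\notin F_\phi$, $$G_{n_\phi}(\phi_a)\cong\operatorname{Aut}(T_{n_\phi})\quad\text{implies that}\quad G_\infty(\phi_a)\cong\operatorname{Aut}(T_\infty).$$ Furthermore, $$\sup_{\substack{a\in\mathbb{Z},\ a\notin F_\phi\\ \phi_a\text{ is stable}}}\Big\{\big[\operatorname{Aut}(T_\infty):G_\infty(\phi_a)\big]\Big\}\quad\text{is finite.}$$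
   Context: Iterates: $\phi^n$ denotes the $n$-fold composition of $\phi$ with itself in the variable $x$ (similarly for $\phi_a$). In particular $\phi(\gamma)=c$ and $\phi^2(\gamma)=(c-\gamma)^2+c$ are elements of $\mathbb{Z}[t]$. Isotrivial: the polynomial $\phi(x)=(x-\gamma)^2+c$ is conjugate, via $x\mapsto x+\gamma$, to $x^2+(c-\gamma)$; it is isotrivial if and only if $c-\gamma$ is a constant polynomial (including $0$). So ''not isotrivial'' means $\deg(c-\gamma)\geq 1$. Stable: $\phi_a$ is stable if every iterate $\phi_a^n$, $n\geq1$, is irreducible over $\mathbb{Q}$. Arboreal Galois groups: for $f\in\mathbb{Q}[x]$ quadratic, $K_n(f)$ is the splitting field of $f^n$ over $\mathbb{Q}$, $G_n(f)=\operatorname{Gal}(K_n(f)/\mathbb{Q})$, $K_\infty(f)=\bigcup_n K_n(f)$ and $G_\infty(f)=\operatorname{Gal}(K_\infty(f)/\mathbb{Q})$. $T_n$ is the complete binary rooted tree with $n$ levels (so $|\operatorname{Aut}(T_n)|=2^{2^n-1}$), and $T_\infty$ is the infinite complete binary rooted tree. When all iterates of $f$ up to the $n$th (respectively all iterates) are separable, the iterated preimages of $0$ under $f$ form the tree $T_n$ (respectively $T_\infty$), with edges given by the action of $f$, and the Galois action embeds $G_n(f)\hookrightarrow\operatorname{Aut}(T_n)$ (respectively $G_\infty(f)\hookrightarrow\operatorname{Aut}(T_\infty)$). The notation $G_n(f)\cong\operatorname{Aut}(T_n)$ (respectively $G_\infty(f)\cong\operatorname{Aut}(T_\infty)$) means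 that these iterates are separable and this embedding is an isomorphism, and $[\operatorname{Aut}(T_\infty):G_\infty(f)]$ is the index of the image. Heights: $h:\overline{\mathbb{Q}}\to\mathbb{R}_{\geq0}$ is the absolute logarithmic (Weil) height, and for a polynomial $f\in\overline{\mathbb{Q}}[x]$, $h(f)$ is the maximum of the heights of its coefficients. Height bound $\mathrm{B}(d)$, for an integer $d\geq3$: there exist constants $C_1=C_1(d)$ and $C_2=C_2(d)$ such that for all $f\in\mathbb{Z}[x]$ of degree $d$ with $\operatorname{disc}(f)\neq0$, if $x,y\in\mathbb{Z}$ satisfy $y^2=f(x)$, then $h(x)\leq C_1\cdot h(f)+C_2$. Versions of $\mathrm{B}(d)$ for $d\leq4$ are the Hall--Lang conjecture; for larger $d$, $\mathrm{B}(d)$ is a consequence of the Vojta conjecture. *)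

(* Defs.v *)
From mathcomp Require Import all_boot all_order all_algebra all_field.
From mathcomp Require Import all_classical all_reals all_analysis.

Set Implicit Arguments.
Unset Strict Implicit.
Unset Printing Implicit Defensive.

Import Order.TTheory GRing.Theory Num.Theory.
Local Open Scope classical_set_scope.
Local Open Scope ring_scope.

Definition iterate (R : nzRingType) (f : {poly R}) (n : nat) : {poly R} :=
  iter n (fun g => f \Po g) 'X.

Definition quad (R : nzRingType) (g c : R) : {poly R} :=
  ('X - g%:P) ^+ 2 + c%:P.

(* The specialization [phi_a], viewed over the rationals. *)
Definition spec (g c : {poly int}) (a : int) : {poly rat} :=
  map_poly intr (quad g.[a] c.[a]).

(* [quad g c] is conjugate by [x |-> x + g] to [x ^ 2 + (c - g)], so over the
   function field it is isotrivial exactly when [c - g] is constant. *)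
Definition isotrivial (g c : {poly int}) : Prop := (size (c - g)%R <= 1)%N.

Definition stable (f : {poly rat}) : Prop :=
  forall n, (1 <= n)%N -> irreducible_poly (iterate f n).

(* Complete binary rooted trees.  A vertex is a word, the root is the empty
   word, and the parent of a nonempty word is its tail.  A tree is given by
   its set of vertices. *)

Definition tree (n : nat) : set (seq bool) := [set w | (size w <= n)%N].

Definition tree_infty : set (seq bool) := [set: seq bool].

(* [behead [::] = [::]], and the root is the only word fixed by [behead], so
   a bijection commuting with [behead] fixes the root and preserves levels.
   The values of [s] outside [V] are irrelevant. *)
Definition tree_aut (V : set (seq bool)) : set (seq bool -> seq bool) :=
  [set s | set_bij V V s /\ forall w, V w -> s (behead w) = behead (s w)].

(* The number of left cosets of [H] in Aut(T_oo) is at most [M]. *)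
Definition index_le (H : set (seq bool -> seq bool)) (M : nat) : Prop :=
  ([set [set s \o t | t in H] | s in tree_aut tree_infty] #<= `I_M)%card.

(* Arboreal Galois groups, inside the algebraic closure [algC] of [rat]. *)

Definition preimages (f : {poly rat}) (n : nat) : set algC :=
  [set z | root (map_poly ratr (iterate f n)) z].

Definition splitting (f : {poly rat}) (n : nat) : set algC :=
  smallest [set K : set algC | divring_closed (mem K)] (preimages f n).

Definition splitting_infty (f : {poly rat}) : set algC :=
  \bigcup_n splitting f n.

(* Gal(K / Q).  An automorphism is represented by any function on [algC]
   extending it; its values outside [K] are irrelevant. *)
Definition galois_group (K : set algC) : set (algC -> algC) :=
  [set s | [/\ set_bij K K s,
               {in K &, {morph s : x y / x + y}},
               {in K &, {morph s : x y / x * y}} &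
               forall q : rat, s (ratr q) = ratr q]].

(* An identification of the complete binary tree [V] with the tree of iterated
   preimages of 0: level m is mapped bijectively onto the zeros of [f^m], and
   taking parents corresponds to applying [f]. *)
Definition labelling (f : {poly rat}) (V : set (seq bool))
    (l : seq bool -> algC) : Prop :=
  forall w, V w ->
    set_bij [set u | size u = size w] (preimages f (size w)) l /\
    (w <> [::] -> (map_poly ratr f).[l w] = l (behead w)).

(* The image of Gal(K / Q) in Aut(V), where [K] contains all the labels. *)
Definition arboreal_image (K : set algC) (V : set (seq bool))
    (l : seq bool -> algC) : set (seq bool -> seq bool) :=
  [set s | tree_aut V s /\
     exists2 sigma, galois_group K sigma &
       forall w, V w -> l (s w) = sigma (l w)].

(* [K] is generated by the labels, so the Galois action on the tree is faithful
   and the embedding is an isomorphism as soon as it is onto. *)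
Definition galois_full (f : {poly rat}) (n : nat) : Prop :=
  (forall m, (m <= n)%N -> separable_poly (iterate f m)) /\
  exists2 l, labelling f (tree n) l &
    arboreal_image (splitting f n) (tree n) l = tree_aut (tree n).

Definition galois_full_infty (f : {poly rat}) : Prop :=
  (forall m, separable_poly (iterate f m)) /\
  exists2 l, labelling f tree_infty l &
    arboreal_image (splitting_infty f) tree_infty l = tree_aut tree_infty.

(* The index of G_oo(f) in Aut(T_oo); it does not depend on the labelling. *)
Definition galois_index_le (f : {poly rat}) (M : nat) : Prop :=
  (forall m, separable_poly (iterate f m)) /\
  exists2 l, labelling f tree_infty l &
    index_le (arboreal_image (splitting_infty f) tree_infty l) M.

(* The absolute logarithmic Weil height on the rationals; [numq x] and [denq x]
   are coprime. *)
Definition height (R : realType) (x : rat) : R :=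
  ln (Num.max `|numq x| `|denq x|)%:~R.

(* Heights are nonnegative, so the default value 0 is harmless. *)
Definition height_poly (R : realType) (f : {poly int}) : R :=
  \big[Num.max/0]_(i < size f) height R (f`_i)%:~R.

Definition disc (F : fieldType) (f : {poly F}) : F :=
  (-1) ^+ 'C((size f).-1, 2) * resultant f f^`() / lead_coef f.

Definition height_bound (R : realType) (d : nat) : Prop :=
  exists C1 C2 : R, forall f : {poly int},
    size f = d.+1 -> disc (map_poly intr f : {poly rat}) != 0 ->
    forall x y : int, y ^+ 2 = f.[x] ->
      height R x%:~R <= C1 * height_poly R f + C2.

(* Partial recursive functions on tuples of natural numbers. *)

Inductive recfun : Type :=
| RZero
| RSucc
| RProj of nat
| RComp of recfun & seq recfun
| RPrim of recfun & recfun
| RMu of recfun.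

(* [computes e v y]: on input [v], the program [e] halts with output [y]. *)
Inductive computes : recfun -> seq nat -> nat -> Prop :=
| CZero v : computes RZero v 0
| CSucc x v : computes RSucc (x :: v) x.+1
| CProj i v : (i < size v)%N -> computes (RProj i) v (nth 0%N v i)
| CComp f gs v ws y :
    computes_all gs v ws -> computes f ws y -> computes (RComp f gs) v y
| CPrim0 f g v y : computes f v y -> computes (RPrim f g) (0%N :: v) y
| CPrimS f g n v z y :
    computes (RPrim f g) (n :: v) z -> computes g [:: n, z & v] y ->
    computes (RPrim f g) (n.+1 :: v) y
| CMu f v n (k : nat -> nat) :
    (forall m, (m < n)%N -> computes f (m :: v) (k m).+1) ->
    computes f (n :: v) 0 -> computes (RMu f) v n
with computes_all : seq recfun -> seq nat -> seq nat -> Prop :=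
| CNil v : computes_all [::] v [::]
| CCons g gs v w ws :
    computes g v w -> computes_all gs v ws ->
    computes_all (g :: gs) v (w :: ws).

Definition int_code (z : int) : nat :=
  match z with Posz n => n.*2 | Negz n => n.*2.+1 end.

(* [CodeSeq.code] is an effective bijection from [seq nat] to [nat].  It is
   applied to coefficient lists of polynomials and to enumerations of finite
   sets of integers. *)
Definition ints_code (s : seq int) : nat := CodeSeq.code (map int_code s).

(* Main.v *)
(** Write [b_n = phi_a^n(gamma(a))] for the critical orbit and [K_n] for the
    field of the level-[n] preimages of 0.  The level-[n + 1] preimages are
    obtained by adjoining square roots of the numbers [l - c(a)], where [l]
    runs over level [n], and these multiply up to [b_(n+1)].  If Galois acts
    transitively on level [n], a nontrivial relation modulo squares of [K_n]
    between them can be made invariant, because the group is a 2-group acting on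
    a space over [F_2]; it then says that [b_(n+1)] is a square in [K_n].  So it
    suffices to rule out that [b_n] is a square in [K_(n-1)] for large [n]:
    the index is then bounded by the size of the group of a fixed level.

    If [b_n] is such a square, every odd prime [p] dividing [b_n] to an odd power
    ramifies in [K_(n-1)], so it divides some [b_j] with [j < n]; hence it divides
    [b_j] or [phi_a^j(0)] for some [j <= n / 2].  Then [b_n = d y^2] where
    [d] is much smaller than [b_n], which gives an integral point with
    huge abscissa [b_(n-k)] on the curve [Y^2 = d phi_a^k(X)], of degree 4 or 8,
    against the height bound.  The growth of [b_n] needed here only requires
    [|c(a) - gamma(a)| >= max(3, |a| / 2)], which, as [c - gamma] is not constant,
    fails only for [|a|] below a bound read off the coefficients. *)
From HB Require Import structures.
Require Import Defs.
From mathcomp Require Import all_boot all_order all_algebra all_field.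
From mathcomp Require Import all_classical all_reals all_analysis.
From mathcomp Require Import ring lra zify.

Set Implicit Arguments.
Unset Strict Implicit.
Unset Printing Implicit Defensive.

Import Order.TTheory GRing.Theory Num.Theory.
Local Open Scope classical_set_scope.
Local Open Scope ring_scope.

(** * Subfields of the algebraic numbers and their automorphisms *)

Definition subfld (K : set algC) : Prop := divring_closed (mem K).

Lemma subfldP (K : set algC) :
  subfld K <-> [/\ K 1, forall x y, K x -> K y -> K (x - y) &
                   forall x y, K x -> K y -> K (x / y)].
Proof.
split=> [[K1 KB KV]|[K1 KB KV]].
  split=> [|x y Kx Ky|x y Kx Ky]; first by have := K1; rewrite inE.
    by have := KB x y; rewrite !inE; apply.
  by have := KV x y; rewrite !inE; apply.
by split=> [|x y|x y]; rewrite !inE //; [apply: KB | apply: KV].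
Qed.

Section SubfldTheory.
Variables (K : set algC) (hK : subfld K).

Lemma subfld1 : K 1. Proof. by have [] := (subfldP K).1 hK. Qed.

Lemma subfldB x y : K x -> K y -> K (x - y).
Proof. by have [_ + _] := (subfldP K).1 hK; apply. Qed.

Lemma subfld_div x y : K x -> K y -> K (x / y).
Proof. by have [_ _] := (subfldP K).1 hK; apply. Qed.

Lemma subfld0 : K 0.
Proof. by rewrite -(subrr 1); apply: subfldB; apply: subfld1. Qed.

Lemma subfldN x : K x -> K (- x).
Proof. by rewrite -sub0r; apply/subfldB/subfld0. Qed.

Lemma subfldD x y : K x -> K y -> K (x + y).
Proof. by move=> Kx Ky; rewrite -[y]opprK; apply/subfldB/subfldN. Qed.

Lemma subfldV x : K x -> K x^-1.
Proof. by rewrite -div1r; apply/subfld_div/subfld1. Qed.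

Lemma subfldM x y : K x -> K y -> K (x * y).
Proof. by move=> Kx Ky; rewrite -[y]invrK; apply/subfld_div/subfldV. Qed.

Lemma subfld_nat n : K n%:R.
Proof.
elim: n => [|n IHn]; first exact: subfld0.
by rewrite -addn1 natrD; apply/subfldD/subfld1.
Qed.

Lemma subfld_int (z : int) : K z%:~R.
Proof.
by case: z => n; rewrite ?NegzE ?mulrNz; [|apply: subfldN]; apply: subfld_nat.
Qed.

Lemma subfld_rat (q : rat) : K (ratr q).
Proof. by rewrite /ratr; apply: subfld_div; apply: subfld_int. Qed.

Lemma subfld_sum (I : Type) (r : seq I) (P : pred I) (F : I -> algC) :
  (forall i, P i -> K (F i)) -> K (\sum_(i <- r | P i) F i).
Proof. by move=> KF; elim/big_ind: _ => //; [apply: subfld0 | apply: subfldD]. Qed.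

Lemma subfld_prod (I : Type) (r : seq I) (P : pred I) (F : I -> algC) :
  (forall i, P i -> K (F i)) -> K (\prod_(i <- r | P i) F i).
Proof. by move=> KF; elim/big_ind: _ => //; [apply: subfld1 | apply: subfldM]. Qed.

Lemma subfldX x n : K x -> K (x ^+ n).
Proof.
move=> Kx; elim: n => [|n IHn]; first exact: subfld1.
by rewrite exprS; apply: subfldM.
Qed.

Lemma subfld_horner (p : {poly algC}) x :
  (forall i, K p`_i) -> K x -> K p.[x].
Proof.
move=> Kp Kx; rewrite horner_coef; apply: subfld_sum => i _.
by apply: subfldM => //; apply: subfldX.
Qed.

End SubfldTheory.

Definition gen (X : set algC) : set algC := smallest subfld X.

Lemma gen_subfld X : subfld (gen X).
Proof.
apply/subfldP; split.
- by move=> K [hK _]; apply: subfld1.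
- by move=> x y Kx Ky K [hK XK]; apply: subfldB => //; [apply: Kx | apply: Ky].
- by move=> x y Kx Ky K [hK XK]; apply: subfld_div => //; [apply: Kx | apply: Ky].
Qed.

Lemma sub_gen X : X `<=` gen X.
Proof. exact: sub_gen_smallest. Qed.

Lemma gen_min X K : subfld K -> X `<=` K -> gen X `<=` K.
Proof. exact: smallest_sub. Qed.

Lemma genS X Y : X `<=` gen Y -> gen X `<=` gen Y.
Proof. by move=> h; apply: gen_min => //; apply: gen_subfld. Qed.

Lemma equalizer_subfld (mu nu : {rmorphism algC -> algC}) :
  subfld [set x | mu x = nu x].
Proof.
apply/subfldP; split=> /= [|x y hx hy|x y hx hy]; first by rewrite !rmorph1.
  by rewrite !rmorphB hx hy.
by rewrite !fmorph_div hx hy.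
Qed.

Lemma gen_equal (X : set algC) (mu nu : {rmorphism algC -> algC}) :
  (forall x, X x -> mu x = nu x) -> forall x, gen X x -> mu x = nu x.
Proof.
move=> h; apply: (@gen_min X [set x | mu x = nu x]); last exact: h.
exact: equalizer_subfld.
Qed.

Lemma gen_morph (X Y : set algC) (nu : {rmorphism algC -> algC}) :
  (forall x, X x -> gen Y (nu x)) -> forall x, gen X x -> gen Y (nu x).
Proof.
move=> h; apply: (@gen_min X [set x | gen Y (nu x)]) => [|x Xx]; last exact: h.
have hY := gen_subfld Y.
apply/subfldP; split=> /= [|x y hx hy|x y hx hy].
- by rewrite rmorph1; apply: subfld1 hY.
- by rewrite rmorphB; apply: (subfldB hY).
- by rewrite fmorph_div; apply: (subfld_div hY).
Qed.

(** Link between the abstract extension [<<1 & s1>>] and [gen]: by induction on the generators, an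
    element is a polynomial in the last one over the field of the others. *)
Lemma num_field_gen (Qs : fieldExtType rat) (QsC : {rmorphism Qs -> algC})
    (s1 : seq Qs) y :
  y \in <<1 & s1>>%VS -> gen [set` map QsC s1] (QsC y).
Proof.
elim/last_ind: s1 y => [|s1 x IHs] y.
  rewrite Fadjoin_nil => /vlineP[q ->].
  rewrite alg_num_field fmorph_rat; exact: subfld_rat (gen_subfld _) q.
rewrite adjoin_rcons => /Fadjoin_poly_eq <-.
set p := Fadjoin_poly _ _ _.
have hp : p \is a polyOver <<1 & s1>>%VS by apply: Fadjoin_polyOver.
have sub : gen [set` map QsC s1] `<=` gen [set` map QsC (rcons s1 x)].
  apply: genS => z /= hz; apply: sub_gen => /=.
  by rewrite map_rcons mem_rcons inE hz orbT.
rewrite -horner_map; apply: (subfld_horner (gen_subfld _)) => [i|].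
  by rewrite coef_map; apply: sub; apply: IHs; exact: (polyOverP hp).
by apply: sub_gen; rewrite /= map_rcons mem_rcons inE eqxx.
Qed.

(* [s] is enlarged by the conjugates of its elements and of [z], so that the
   number field it generates is Galois. *)
Lemma gen_galois_moves (s : seq algC) z :
  ~ gen [set` s] z ->
  exists nu : {rmorphism algC -> algC},
    (forall x, gen [set` s] x -> nu x = x) /\ nu z <> z.
Proof.
move=> Nz.
have /all_sig[P hP] (x : algC) : {p : {poly rat} | p \is monic /\
    root (map_poly ratr p) x}.
  have [p [Dp mp] dv] := minCpolyP x.
  by exists p; split=> //; rewrite dv.
pose p : {poly rat} := \prod_(x <- z :: s) P x.
have mp : p \is monic by apply: monic_prod => x _; case: (hP x).
have pC : map_poly ratr p = \prod_(x <- z :: s) map_poly ratr (P x) :> {poly algC}.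
  by rewrite rmorph_prod.
have rp x : x \in z :: s -> root (map_poly ratr p : {poly algC}) x.
  move=> sx; rewrite pC (big_rem x) //= rootM.
  by have [_ ->] := hP x.
have [rs Drs] := closed_field_poly_normal (map_poly ratr p : {poly algC}).
rewrite (monicP _) ?scale1r in Drs; last by rewrite monic_map.
have rsP x : x \in z :: s -> x \in rs.
  by move/rp; rewrite Drs root_prod_XsubC.
have [Qs [QsC [s1 Ds1 s1full]]] := num_field_exists rs.
have Dp1 : map_poly (in_alg Qs) p = \prod_(x <- s1) ('X - x%:P).
  apply: (map_poly_inj QsC); rewrite [RHS]rmorph_prod -map_poly_comp /=.
  have -> : map_poly (QsC \o in_alg Qs) p = map_poly ratr p.
    by apply: eq_map_poly => q /=; rewrite alg_num_field fmorph_rat.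
  rewrite Drs -Ds1 big_map; apply: eq_bigr => x _.
  by rewrite map_polyXsubC.
have ax : splitting_field_axiom Qs.
  exists (map_poly (in_alg Qs) p).
    by apply/polyOverP=> i; rewrite coef_map /= memvZ ?mem1v.
  by exists s1; rewrite ?Dp1 ?eqpxx.
pose L : splittingFieldType rat := HB.pack Qs (FieldExt_isSplittingField.Build rat Qs ax).
pose LC : {rmorphism L -> algC} := QsC.
have liftP x : x \in rs -> {y : L | LC y = x}.
  rewrite -Ds1 => hx; have := hx; move/mapP/sig2_eqW => [y _ ->].
  by exists y.
have [z1 Dz1] := liftP z (rsP _ (mem_head _ _)).
have [s2 Ds2] : {s2 : seq L | map LC s2 = s}.
  have : {subset s <= rs} by move=> x sx; apply: rsP; rewrite inE sx orbT.
  elim: (s) => [_|x s' IH hs]; first by exists [::].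
  have [y Dy] := liftP x (hs _ (mem_head _ _)).
  have [|s2 Ds2] := IH; first by move=> t ht; apply: hs; rewrite inE ht orbT.
  by exists (y :: s2); rewrite /= Dy Ds2.
pose F : {subfield L} := <<1 & s2>>%AS.
have Fz : z1 \notin F.
  apply/negP => Fz1; apply: Nz; rewrite -Ds2 -Dz1.
  apply: num_field_gen. exact: Fz1.
have pF : map_poly (in_alg Qs) p \is a polyOver F.
  by apply/polyOverP=> i; rewrite coef_map /= memvZ ?mem1v.
have gal : galois F {:L}.
  apply/and3P; split; first exact: subvf.
    apply/separableP => y _; apply: pcharf0_separable => q.
    by rewrite pchar_lalg; apply: pchar_num.
  apply/splitting_normalField; first exact: subvf.
  exists (map_poly (in_alg Qs) p) => //; exists s1; first by rewrite Dp1 eqpxx.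
  have s1L : <<1 & s1>>%VS = {:L}%VS := s1full.
  apply/eqP; rewrite eqEsubv subvf /=.
  apply: (@subv_trans _ _ <<1 & s1>>%VS); first by rewrite s1L.
  apply/Fadjoin_seqP; split.
    by rewrite sub1v.
  by move=> x; apply: seqv_sub_adjoin.
have : z1 \notin fixedField 'Gal({:L} / F)%g.
  by rewrite (galois_fixedField gal).
move=> hfix.
have [g gG gz] : exists2 g, g \in 'Gal({:L} / F)%g & g z1 <> z1.
  apply: contrapT => h; move/negP: hfix; apply.
  apply/fixedFieldP; first exact: memvf.
  by move=> g gG; apply: contrapT => gz; apply: h; exists g.
have [nu hnu] := extend_algC_subfield_aut LC (gal_repr g : {rmorphism L -> L}).
exists nu; split; last by rewrite -Dz1 -hnu => /fmorph_inj.
apply: (@gen_equal _ nu idfun) => x /=; rewrite -Ds2 => /mapP[y sy ->].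
rewrite -hnu; congr (LC _); apply: (fixed_gal _ gG); first exact: subvf.
exact: seqv_sub_adjoin.
Qed.

(** [sigma] is constrained only on the field generated by [s]; there it is an endomorphism of a
    number field, and such maps extend to [algC]. *)
Lemma galois_group_extend (s : seq algC) (sigma : algC -> algC) :
  galois_group (gen [set` s]) sigma ->
  exists nu : {rmorphism algC -> algC},
    forall x, gen [set` s] x -> nu x = sigma x.
Proof.
move=> [[sK _ _] sD sM sQ].
have [Qs [QsC [s1 Ds1 s1full]]] := num_field_exists s.
have QsK y : gen [set` s] (QsC y).
  by rewrite -Ds1; apply: num_field_gen; rewrite s1full memvf.
have KQs x : gen [set` s] x -> exists y, x = QsC y.
  apply: (@gen_min _ [set x | exists y, x = QsC y]) => [|t] /=; last first.
    by rewrite -Ds1 => /mapP[y _ ->]; exists y.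
  apply/subfldP; split=> /=.
  - by exists 1; rewrite rmorph1.
  - by move=> _ _ [u ->] [v ->]; exists (u - v); rewrite rmorphB.
  - by move=> _ _ [u ->] [v ->]; exists (u / v); rewrite fmorph_div.
have [phi hphi] : {phi : Qs -> Qs | forall y, QsC (phi y) = sigma (QsC y)}.
  have h y : {z | sigma (QsC y) = QsC z}.
    by apply/cid/KQs; apply: sK; apply: QsK.
  by exists (fun y => sval (h y)) => y; case: (h y).
have sig1 : sigma 1 = 1 by have := sQ 1; rewrite rmorph1.
have sigB x y : gen [set` s] x -> gen [set` s] y ->
    sigma (x - y) = sigma x - sigma y.
  move=> hx hy; apply/eqP; rewrite eq_sym subr_eq -sD ?inE ?subrK //.
  exact: (subfldB (gen_subfld _)) hx hy.
have phiB : zmod_morphism phi.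
  move=> x y; apply: (fmorph_inj QsC).
  by rewrite rmorphB !hphi rmorphB sigB.
have phiM : monoid_morphism phi.
  split=> [|x y]; apply: (fmorph_inj QsC); first by rewrite hphi !rmorph1.
  by rewrite rmorphM !hphi rmorphM sM ?inE.
pose phiBM := GRing.isZmodMorphism.Build Qs Qs phi phiB.
pose phiMM := GRing.isMonoidMorphism.Build Qs Qs phi phiM.
pose phiR : {rmorphism Qs -> Qs} := HB.pack phi phiBM phiMM.
have [nu hnu] := extend_algC_subfield_aut QsC phiR.
by exists nu => x /KQs[y ->]; rewrite -hnu /= hphi.
Qed.

Lemma gen_nil_rat x : gen [set` [::]] x -> exists q : rat, x = ratr q.
Proof.
apply: (@gen_min _ [set x | exists q : rat, x = ratr q]) => [|t] //=.
apply/subfldP; split=> /=.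
- by exists 1; rewrite rmorph1.
- by move=> _ _ [u ->] [v ->]; exists (u - v); rewrite rmorphB.
- by move=> _ _ [u ->] [v ->]; exists (u / v); rewrite fmorph_div.
Qed.

Lemma fixed_rat x : (forall nu : {rmorphism algC -> algC}, nu x = x) ->
  exists q : rat, x = ratr q.
Proof.
move=> hx; apply: gen_nil_rat; apply: contrapT => /gen_galois_moves[nu [_]].
by rewrite hx.
Qed.

(** The product of ['X - r] over the Galois orbit of [x] is invariant, hence rational. As [p] is
    irreducible and shares the root [x], it divides this product, so [y] is in the orbit. *)
Lemma irreducible_galois_transitive (p : {poly rat}) x y :
  irreducible_poly p ->
  root (map_poly ratr p) x -> root (map_poly ratr p) y ->
  exists nu : {rmorphism algC -> algC}, nu x = y.
Proof.
move=> irr px py.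
have p0 : map_poly ratr p != 0 :> {poly algC}.
  by rewrite map_poly_eq0 irredp_neq0.
have [rs Drs] := closed_field_poly_normal (map_poly ratr p : {poly algC}).
have rsP z : (z \in rs) = root (map_poly ratr p) z.
  by rewrite Drs rootZ ?root_prod_XsubC // lead_coef_eq0.
pose T := undup [seq r <- rs | `[< exists nu : {rmorphism algC -> algC}, nu x = r >]].
have TP z : (z \in T) = `[< exists nu : {rmorphism algC -> algC}, nu x = z >].
  rewrite mem_undup mem_filter rsP andb_idr // => /asboolP[nu <-].
  have -> : map_poly ratr p = map_poly nu (map_poly ratr p).
    by rewrite -map_poly_comp; apply: eq_map_poly => q /=; rewrite fmorph_rat.
  by rewrite fmorph_root.
pose h : {poly algC} := \prod_(r <- T) ('X - r%:P).
have hfix (nu : {rmorphism algC -> algC}) : map_poly nu h = h.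
  rewrite /h rmorph_prod /=.
  under eq_bigr do rewrite map_polyXsubC.
  rewrite -(big_map nu xpredT (fun r => 'X - r%:P)); apply: perm_big.
  apply: uniq_perm; rewrite ?undup_uniq ?(map_inj_uniq (fmorph_inj nu)) ?undup_uniq //.
  move=> z; apply/mapP/idP => [[r rT ->]|zT].
    move: rT; rewrite !TP => /asboolP[mu <-]; apply/asboolP.
    by exists (nu \o mu).
  exists (algC_invaut nu z); last by rewrite algC_invautK.
  move: zT; rewrite !TP => /asboolP[mu <-]; apply/asboolP.
  by exists (algC_invaut nu \o mu).
have [q Dq] : exists q : {poly rat}, h = map_poly ratr q.
  have hq i : {q : rat | h`_i = ratr q}.
    by apply/cid/fixed_rat => nu; rewrite -coef_map hfix.
  exists (\poly_(i < size h) sval (hq i)); apply/polyP=> i.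
  rewrite coef_map coef_poly; case: ltnP => [_|/(nth_default 0) ->].
    by case: (hq i).
  by rewrite raddf0.
have xq : root (map_poly ratr q) x.
  by rewrite -Dq root_prod_XsubC TP; apply/asboolP; exists idfun.
have pq : p %| q.
  apply/negPn; rewrite -irreducible_poly_coprime //.
  rewrite -(coprimep_map (ratr : {rmorphism rat -> algC})).
  by apply/negP => /coprimep_root/(_ px); rewrite (rootP xq) eqxx.
have : root (map_poly ratr q) y.
  case/dvdpP: pq => k ->; rewrite rmorphM rootM py orbT //.
by rewrite -Dq root_prod_XsubC TP => /asboolP.
Qed.

(** * Kummer theory *)

Lemma gen_adjoin_sqrt (K : set algC) t x :
  subfld K -> K (t ^+ 2) -> gen (K `|` [set t]) x ->
  exists u v, [/\ K u, K v & x = u + v * t].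
Proof.
move=> hK Kt2.
have [Kt|NKt] := pselect (K t).
  move=> hx; exists x, 0; split; rewrite ?mul0r ?addr0 //; last exact: subfld0.
  by apply: (gen_min hK) hx => z [//|->].
pose T := [set x | exists u v, [/\ K u, K v & x = u + v * t]].
suff hT : subfld T.
  apply: (@gen_min _ T) => // z [Kz|->].
    by exists z, 0; rewrite mul0r addr0; split=> //; apply: subfld0.
  by exists 0, 1; rewrite mul1r add0r; split=> //; [apply: subfld0|apply: subfld1].
have TM : forall x y, T x -> T y -> T (x * y).
  move=> _ _ [u [v [Ku Kv ->]]] [u' [v' [Ku' Kv' ->]]].
  exists (u * u' + v * v' * t ^+ 2), (u * v' + v * u'); split; last by ring.
    exact: (subfldD hK) (subfldM hK Ku Ku') (subfldM hK (subfldM hK Kv Kv') Kt2).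
  exact: (subfldD hK) (subfldM hK Ku Kv') (subfldM hK Kv Ku').
apply/subfldP; split.
- by exists 1, 0; rewrite mul0r addr0; split=> //; [apply: subfld1|apply: subfld0].
- move=> _ _ [u [v [Ku Kv ->]]] [u' [v' [Ku' Kv' ->]]].
  exists (u - u'), (v - v'); split; last by ring.
    exact: (subfldB hK).
  exact: (subfldB hK).
- move=> a b Ta [u [v [Ku Kv ->]]]; apply: (TM) => //.
  have [->|nz] := eqVneq (u + v * t) 0.
    by rewrite invr0; exists 0, 0; rewrite mul0r addr0; split=> //; apply: subfld0.
  (* The inverse will be the conjugate over the norm. If the conjugate vanished, either [t = u / v]
     would lie in [K] or [u] and [v] would both be 0. *)
  have nz' : u - v * t != 0.
    apply: contra nz => /eqP h.
    have [v0|v0] := eqVneq v 0; first by move: h; rewrite v0 !mul0r subr0 => ->; rewrite addr0.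
    case: NKt; have -> : t = u / v.
      apply: (mulIf v0); rewrite divfK //; apply/eqP.
      by rewrite -subr_eq0 mulrC -oppr_eq0 opprB h.
    exact: (subfld_div hK).
  pose n := u ^+ 2 - v ^+ 2 * t ^+ 2.
  have Dn : n = (u + v * t) * (u - v * t) by rewrite /n; ring.
  have n0 : n != 0 by rewrite Dn mulf_neq0.
  have Kn : K n.
    exact: (subfldB hK) (subfldX hK 2 Ku) (subfldM hK (subfldX hK 2 Kv) Kt2).
  exists (u / n), (- v / n); split.
  + exact: (subfld_div hK).
  + by apply: (subfld_div hK) => //; apply: (subfldN hK).
  + have -> : u / n + - v / n * t = (u - v * t) / n by ring.
    by rewrite Dn invfM mulrCA divff ?mulr1.
Qed.

(* If the product of [r] lies in [K(t)] with its square in [K], then one of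
   the products of [r] and of [t :: r] lies in [K]. *)
Lemma kummer_independent (ts : seq algC) t0 (K : set algC) :
  subfld K -> (forall t, t \in rcons ts t0 -> K (t ^+ 2)) ->
  (forall r, subseq r (rcons ts t0) -> r <> [::] -> ~ K (\prod_(x <- r) x)) ->
  ~ gen (K `|` [set` ts]) t0.
Proof.
elim: ts K => [|t ts IHts] K hK; rewrite ?rcons_cons => K2 Kprod.
  move=> h; apply: (Kprod [:: t0] (subseq_refl _)) => //.
  by rewrite big_seq1; apply: (gen_min hK) h => z [|].
move=> h.
pose K1 := gen (K `|` [set t]).
have KK1 : K `<=` K1 by move=> z Kz; apply: sub_gen; left.
have hK1 : subfld K1 := gen_subfld _.
apply: (IHts K1) => //.
- by move=> z hz; apply: KK1; apply: K2; rewrite inE hz orbT.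
- move=> r sr r0 K1r.
  have [u [v [Ku Kv Dr]]] := gen_adjoin_sqrt hK (K2 t (mem_head _ _)) K1r.
  have sr' : subseq r (t :: rcons ts t0) by apply: subseq_trans sr (subseq_cons _ _).
  have str : subseq (t :: r) (t :: rcons ts t0) by rewrite /= eqxx.
  have Kt : ~ K t.
    move=> Kt; apply: (Kprod [:: t]) => //; last by rewrite big_seq1.
    by rewrite /= eqxx sub0seq.
  have t0' : t != 0.
    by apply: contra_notN Kt => /eqP ->; apply: subfld0.
  have K2r : K ((\prod_(x <- r) x) ^+ 2).
    rewrite -prodrXl big_seq; apply: (subfld_prod hK) => x xr; apply: K2.
    by rewrite inE (mem_subseq sr xr) orbT.
  have [v0|v0] := eqVneq v 0.
    by apply: (Kprod r) => //; rewrite Dr v0 mul0r addr0.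
  have [u0|u0] := eqVneq u 0.
    apply: (Kprod (t :: r)) => //; rewrite big_cons Dr u0 add0r mulrCA -expr2.
    by apply: (subfldM hK) => //; apply: K2; rewrite mem_head.
  apply: Kt.
  (* Squaring [u + v * t], with [u] and [v] nonzero, isolates the term [2 * u * v * t]. *)
  have -> : t = ((\prod_(x <- r) x) ^+ 2 - u ^+ 2 - v ^+ 2 * t ^+ 2) / (2 * u * v).
    have nz : 2 * u * v != 0 by rewrite !mulf_neq0 // pnatr_eq0.
    by rewrite Dr; apply: (mulIf nz); rewrite divfK //; ring.
  have Kt2 : K (t ^+ 2) by apply: K2; rewrite mem_head.
  apply: (subfld_div hK).
    apply: (subfldB hK (subfldB hK K2r (subfldX hK 2 Ku))).
    exact: (subfldM hK (subfldX hK 2 Kv) Kt2).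
  exact: (subfldM hK (subfldM hK (subfld_nat hK 2) Ku) Kv).
- apply: (genS _ h) => z [Kz|]; first by apply: sub_gen; left; apply: KK1.
  rewrite /= inE => /orP[/eqP ->|zts]; last by apply: sub_gen; right.
  by apply: sub_gen; left; apply: sub_gen; right.
Qed.

(** * Invariant subsets of a level of the tree *)

(* The functions in [V] are subsets of level [m], added modulo 2.  If [V]
   contains no nonzero function pulled back from level [m - 1], then summing
   over siblings is injective on [V]; the preimage of the all-ones function is
   then invariant under [G], hence constant, which is absurd. *)
Lemma transitive_all_ones (m : nat) (V : set (seq bool -> bool))
    (G : set (seq bool -> seq bool)) :
  (forall J J', V J -> V J' -> V (fun w => J w (+) J' w)) ->
  (forall s J, G s -> V J -> V (J \o s)) ->
  (forall s, G s -> [/\ forall w, size w <= m -> size (s w) = size w,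
     forall w, size w <= m -> s (behead w) = behead (s w) &
     {in [pred w | size w <= m] &, injective s}])%N ->
  (forall w w', size w = m -> size w' = m -> exists2 s, G s & s w = w') ->
  (exists2 J, V J & exists2 w, size w = m & J w) ->
  exists2 J, V J & forall w, size w = m -> J w.
Proof.
elim: m V => [|m IHm] V Vadd VG Gtree Gtr [J VJ [w sw Jw]].
  by exists J => // w'; move: w sw Jw => [|//] _ Jw; case: w'.
have Gtree' s : G s -> [/\ forall w, size w <= m -> size (s w) = size w,
     forall w, size w <= m -> s (behead w) = behead (s w) &
     {in [pred w | size w <= m] &, injective s}]%N.
  move=> /Gtree[h1 h2 h3]; split=> [u hu|u hu|u v hu hv]; first exact/h1/leqW.
    exact/h2/leqW.
  by apply: h3; rewrite inE leqW.
have Gtr' u u' : size u = m -> size u' = m -> exists2 s, G s & s u = u'.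
  move=> hu hu'; have [|| s Gs es] := Gtr (false :: u) (false :: u').
  - by rewrite /= hu.
  - by rewrite /= hu'.
  exists s => //; have [_ h2 _] := Gtree _ Gs.
  by rewrite -[u]/(behead (false :: u)) h2 ?es //= hu.
have Gchild s b u : G s -> size u = m -> exists b', s (b :: u) = b' :: s u.
  move=> Gs hu; have [h1 h2 h3] := Gtree _ Gs.
  have hs : (size (b :: u) <= m.+1)%N by rewrite /= hu.
  have := h1 _ hs; have := h2 _ hs; case: (s (b :: u)) => [|b' v] //= -> _.
  by exists b'.
pose pulled (K J : seq bool -> bool) := forall (b : bool) u, size u = m -> J (b :: u) = K u.
(* Either a nonzero function of [V] is pulled back from level [m], and induction applies to the
   functions having a pullback in [V], or summing over siblings has trivial kernel on [V]. *)
have [[J0 VJ0 [K pJ0 [u su Ku]]]|Nexp] := pselect (exists2 J, V J &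
    exists2 K, pulled K J & exists2 u, size u = m & K u).
  have [|||K' [J1 VJ1 pJ1] hK'] :=
    IHm [set K | exists2 J, V J & pulled K J] _ _ Gtree' Gtr' _.
  - move=> K1 K2 [J1 V1 p1] [J2 V2 p2]; exists (fun w => J1 w (+) J2 w).
      exact: Vadd.
    by move=> b v hv; rewrite p1 ?p2.
  - move=> s K1 Gs [J1 V1 p1]; exists (J1 \o s); first exact: VG.
    move=> b v hv /=; have [b' ->] := Gchild s b v Gs hv.
    by apply: p1; have [-> //] := Gtree' _ Gs; rewrite hv.
  - by exists K; [exists J0|exists u].
  exists J1 => // -[//|b v] [hv]; by rewrite pJ1 ?hK'.
pose sibs (K J : seq bool -> bool) :=
    forall u, size u = m -> K u = J (false :: u) (+) J (true :: u).
(* [s] may exchange the two children of a vertex, but their sum is symmetric. *)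
have sibs_comp s K1 J1 : G s -> sibs K1 J1 -> sibs (K1 \o s) (J1 \o s).
  move=> Gs p1 v hv /=.
  have [b eb] := Gchild s false v Gs hv; have [b' eb'] := Gchild s true v Gs hv.
  have [h1 h2 h3] := Gtree _ Gs.
  have bb' : b != b'.
    apply/eqP => E; have : false :: v = true :: v; last by [].
    by apply: h3; rewrite ?inE /= ?hv // eb eb' E.
  rewrite p1; last by rewrite h1 hv.
  by rewrite eb eb'; case: (b) (b') bb' => -[] // _; rewrite addbC.
have sibs_nz J2 : V J2 -> (exists2 w, size w = m.+1 & J2 w) ->
    exists2 u, size u = m & J2 (false :: u) (+) J2 (true :: u).
  move=> VJ2 [[//|b u] [su] J2w]; apply: contrapT => h.
  have eJ2 v : size v = m -> J2 (true :: v) = J2 (false :: v).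
    move=> sv; apply/eqP; apply: contra_notT h => ne; exists v => //.
    by case: (J2 _) (J2 _) ne => -[].
  apply: Nexp; exists J2 => //; exists (fun u => J2 (false :: u)).
    by move=> [] v sv //; rewrite eJ2.
  by exists u => //; case: b J2w => //; rewrite eJ2.
have [|||K [J1 VJ1 pJ1] hK] :=
    IHm [set K | exists2 J, V J & sibs K J] _ _ Gtree' Gtr' _.
- move=> K1 K2 [J1 V1 p1] [J2 V2 p2]; exists (fun w => J1 w (+) J2 w).
    exact: Vadd.
  by move=> v hv; rewrite p1 ?p2 //; rewrite addbACA.
- move=> s K1 Gs [J1 V1 p1]; exists (J1 \o s); [exact: VG|exact: sibs_comp].
- exists (fun u => J (false :: u) (+) J (true :: u)); first by exists J.
  by apply: sibs_nz => //; exists w.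
(* [J1 \o s] and [J1] have the same sibling sums, all equal to 1, so their difference lies in the
   trivial kernel. *)
have Jinv s v : G s -> size v = m.+1 -> J1 (s v) = J1 v.
  move=> Gs sv; apply/eqP; apply: contraT => ne.
  have [||u su] := sibs_nz (fun w => J1 (s w) (+) J1 w).
  - by apply: Vadd => //; apply: VG.
  - by exists v => //; case: (J1 _) (J1 _) ne => -[].
  have := sibs_comp _ _ _ Gs pJ1 u su; have := pJ1 u su; rewrite /= !hK //.
    by do 4!case: (J1 _).
  by have [-> //] := Gtree' _ Gs; rewrite su.
(* By transitivity the invariant [J1] agrees on two siblings, although their sum is 1. *)
pose v0 := nseq m false.
have sv0 : size v0 = m by rewrite size_nseq.
have [||s Gs es] := Gtr (false :: v0) (true :: v0); rewrite /= ?sv0 //.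
have := hK v0 sv0; rewrite pJ1 // -es (Jinv s) //= ?sv0 //.
by rewrite addbb.
Qed.

(** * Unramified primes *)

Definition subrg (B : set algC) : Prop :=
  [/\ B 1, forall x y, B x -> B y -> B (x - y) &
           forall x y, B x -> B y -> B (x * y)].

Definition cong (B : set algC) (p : nat) (x y : algC) : Prop :=
  exists2 w, B w & x - y = p%:R * w.

Section Subrg.
Variables (B : set algC) (hB : subrg B).

Lemma subrg1 : B 1. Proof. by case: hB. Qed.

Lemma subrgB x y : B x -> B y -> B (x - y).
Proof. by case: hB => _ + _; apply. Qed.

Lemma subrgM x y : B x -> B y -> B (x * y).
Proof. by case: hB => _ _; apply. Qed.

Lemma subrg0 : B 0.
Proof. by rewrite -(subrr 1); apply: subrgB; apply: subrg1. Qed.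

Lemma subrgN x : B x -> B (- x).
Proof. by rewrite -sub0r; apply/subrgB/subrg0. Qed.

Lemma subrgD x y : B x -> B y -> B (x + y).
Proof. by move=> Kx Ky; rewrite -[y]opprK; apply/subrgB/subrgN. Qed.

Lemma subrgX x n : B x -> B (x ^+ n).
Proof.
move=> Bx; elim: n => [|n IHn]; first exact: subrg1.
by rewrite exprS; apply: subrgM.
Qed.

Lemma subrg_nat n : B n%:R.
Proof.
elim: n => [|n IHn]; first exact: subrg0.
by rewrite -addn1 natrD; apply/subrgD/subrg1.
Qed.

Lemma subrg_int (z : int) : B z%:~R.
Proof.
by case: z => n; rewrite ?NegzE ?mulrNz; [|apply: subrgN]; apply: subrg_nat.
Qed.

Lemma subrg_sum (I : Type) (r : seq I) (P : pred I) (F : I -> algC) :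
  (forall i, P i -> B (F i)) -> B (\sum_(i <- r | P i) F i).
Proof. by move=> BF; elim/big_ind: _ => //; [apply: subrg0 | apply: subrgD]. Qed.

Lemma subrg_prod (I : Type) (r : seq I) (P : pred I) (F : I -> algC) :
  (forall i, P i -> B (F i)) -> B (\prod_(i <- r | P i) F i).
Proof. by move=> BF; elim/big_ind: _ => //; [apply: subrg1 | apply: subrgM]. Qed.

Variable p : nat.

Lemma cong_refl x : cong B p x x.
Proof. by exists 0; rewrite ?mulr0 ?subrr //; apply: subrg0. Qed.

Lemma cong_trans y x z : cong B p x y -> cong B p y z -> cong B p x z.
Proof.
move=> [w Bw e] [v Bv e']; exists (w + v); first exact: subrgD.
by rewrite mulrDr -e -e'; ring.
Qed.

Lemma congD x y x' y' :
  cong B p x y -> cong B p x' y' -> cong B p (x + x') (y + y').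
Proof.
move=> [w Bw e] [v Bv e']; exists (w + v); first exact: subrgD.
by rewrite mulrDr -e -e'; ring.
Qed.

Lemma congMl z x y : B z -> cong B p x y -> cong B p (z * x) (z * y).
Proof.
move=> Bz [w Bw e]; exists (z * w); first exact: subrgM.
by rewrite -mulrBr e mulrCA.
Qed.

Lemma congM x y x' y' : B y -> B x' ->
  cong B p x y -> cong B p x' y' -> cong B p (x * x') (y * y').
Proof.
move=> By Bx' c c'; apply: (@cong_trans (y * x')); last exact: congMl.
by rewrite !(mulrC _ x'); apply: congMl.
Qed.

Lemma congX n x y : B x -> B y -> cong B p x y -> cong B p (x ^+ n) (y ^+ n).
Proof.
move=> Bx By c; elim: n => [|n IHn]; first exact: cong_refl.
by rewrite !exprS; apply: congM => //; apply: subrgX.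
Qed.

Lemma cong_expD k x y : prime p -> B x -> B y ->
  cong B p ((x + y) ^+ (p ^ k)) (x ^+ (p ^ k) + y ^+ (p ^ k)).
Proof.
move=> pp Bx By.
have base u v : B u -> B v -> cong B p ((u + v) ^+ p) (u ^+ p + v ^+ p).
  move=> Bu Bv; have p0 := prime_gt0 pp.
  rewrite -(prednK p0) exprDn big_ord_recl big_ord_recr /= (prednK p0).
  rewrite bin0 subn0 expr0 mulr1 mulr1n.
  rewrite /bump /= add1n (prednK p0) subnn expr0 mul1r binn mulr1n.
  exists (\sum_(i < p.-1) (u ^+ (p - i.+1) * v ^+ i.+1) *+ ('C(p, i.+1) %/ p)).
    apply: subrg_sum => i _; rewrite -mulr_natr; apply: subrgM.
      by apply: subrgM; apply: subrgX.
    exact: subrg_nat.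
  set S := (X in _ + (X + _)); transitivity S; first by ring.
  rewrite mulr_sumr; apply: eq_bigr => i _; rewrite /bump /= add1n.
  rewrite mulr_natl -mulrnA divnK //; apply: prime_dvd_bin => //=.
  by have := ltn_ord i; lia.
elim: k => [|k IHk]; first by rewrite expn0 !expr1; apply: cong_refl.
rewrite expnSr !exprM; apply: (@cong_trans ((x ^+ (p ^ k) + y ^+ (p ^ k)) ^+ p)).
  apply: congX IHk; first by apply: subrgX; apply: subrgD.
  by apply: subrgD; apply: subrgX.
by apply: base; apply: subrgX.
Qed.

End Subrg.

(* [p] is unramified in the order [B]: some power of the Frobenius
   endomorphism of [B / p B] is the identity. *)
Definition unram (p : nat) (B : set algC) : Prop :=
  [/\ subrg B, forall x, B x -> x \in Aint &
      exists2 k, (0 < k)%N & forall x, B x -> cong B p (x ^+ (p ^ k)) x].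

(** Descent on [|N|]: if [p] divides [N = y ^+ 2], it divides [y ^+ (p ^ k)] in [B], hence [y] by
    the Frobenius condition, and [p ^ 2] can be removed from [N]. *)
Lemma unram_sqr_even p B y (N : int) :
  prime p -> unram p B -> B y -> y ^+ 2 = N%:~R -> N != 0 ->
  ~~ odd (logn p `|N|).
Proof.
move=> pp [hB BA [k k0 hk]].
have [n] := ubnP `|N|%N; elim: n y N => // n IHn y N ltn By y2 N0.
have [pN|pN] := boolP (p %| `|N|)%N; last first.
  by rewrite lognE pp (negbTE pN) andbF.
have [M DN] : exists M, N = p%:Z * M.
  by exists (N %/ p%:Z)%Z; rewrite mulrC divzK.
have pC0 : p%:R != 0 :> algC by rewrite pnatr_eq0 -lt0n prime_gt0.
have [w Bw Dy] : exists2 w, B w & y = p%:R * w.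
  have [w Bw] := hk y By.
  have pk : (2 <= p ^ k)%N.
    by rewrite -(prednK k0) expnS (leq_trans (prime_gt1 pp)) // leq_pmulr // expn_gt0 prime_gt0.
  rewrite -(subnK pk) exprD y2 DN rmorphM /= => e.
  exists (y ^+ (p ^ k - 2) * M%:~R - w).
    by apply: (subrgB hB) => //; apply: (subrgM hB); [apply: (subrgX hB)|apply: (subrg_int hB)].
  by rewrite mulrBr -e opprB addrCA mulrCA subrr addr0.
have w2 : w ^+ 2 = ratr (M%:~R / p%:R).
  apply: (mulfI pC0); apply: (mulfI pC0); rewrite fmorph_div rmorph_int rmorph_nat.
  rewrite (mulrC p%:R (_ / _)) divfK //.
  by move: y2; rewrite Dy DN rmorphM /= exprMn expr2 -mulrA => ->.
have /intrP[M' DM'] : w ^+ 2 \in Num.int.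
  apply: Cint_rat_Aint; last by apply: BA; apply: (subrgX hB).
  by rewrite w2; apply/CratP; eexists.
have DN' : N = p%:Z ^+ 2 * M'.
  apply: (@intr_inj algC); rewrite -y2 Dy exprMn DM' rmorphM rmorphXn /=.
  by [].
have M0 : M' != 0 by apply: contra N0 => /eqP E; rewrite DN' E mulr0.
have sM : (`|M'| < n)%N.
  have := ltn; rewrite DN' abszM abszX /=; have := prime_gt1 pp.
  have : (0 < `|M'|)%N by rewrite absz_gt0.
  by move: `|M'|%N => m; rewrite expnS expn1; nia.
have p2 : (0 < p ^ 2)%N by rewrite expn_gt0 prime_gt0.
rewrite DN' abszM abszX /= lognM ?absz_gt0 // lognX.
by rewrite oddD oddM /=; apply: (IHn w).
Qed.

(** Fermat's little theorem, by induction from the additivity of Frobenius; oddness of [p] settles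
    the negative integers. *)
Lemma unram_int p : prime p -> odd p -> unram p [set x | exists z : int, x = z%:~R].
Proof.
move=> pp op; set Z := [set x | _].
have hZ : subrg Z.
  split; first by exists 1.
    by move=> _ _ [u ->] [v ->]; exists (u - v); rewrite rmorphB.
  by move=> _ _ [u ->] [v ->]; exists (u * v); rewrite rmorphM.
split=> //; first by move=> _ [z ->]; apply: Aint_int.
exists 1%N => // _ [z ->]; rewrite expn1.
have nat_case (n : nat) : cong Z p (n%:R ^+ p) n%:R.
  elim: n => [|n IHn].
    by rewrite expr0n; case: (p) pp => // q _; apply: cong_refl.
  have Zn : Z n%:R by exists (Posz n).
  have Z1 : Z 1 by exists 1.
  have := cong_expD hZ 1 pp Zn Z1; rewrite expn1 expr1n -addn1 natrD => h.
  exact: (cong_trans hZ) h (congD hZ IHn (cong_refl hZ p 1)).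
case: z => n; first exact: nat_case.
rewrite NegzE mulrNz exprNn -signr_odd op expr1 !mulN1r.
have [w Zw e] := nat_case n.+1; exists (- w); first exact: (subrgN hZ).
by rewrite mulrN -e opprB opprK addrC.
Qed.

Lemma Aint_sqr t : t ^+ 2 \in Aint -> t \in Aint.
Proof.
move=> At; apply: (@root_monic_Aint (minCpoly (t ^+ 2) \Po 'X^2)).
- by rewrite /root horner_comp hornerXn (rootP (root_minCpoly _)).
- rewrite monicE lead_coef_comp ?size_polyXn // lead_coefXn expr1n mulr1.
  by rewrite -monicE minCpoly_monic.
- by apply: polyOver_comp => //; apply: rpredX; apply: polyOverX.
Qed.

(** The hypothesis on [N] makes [t ^+ 2] a unit modulo [p]. With [q = p ^ k], one has
    [t ^+ q = t * e] where [e = t ^+ (q - 1)] lies in [B] and [e * e] is 1 modulo [p]. Raising to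
    the power [q] twice therefore fixes [t], whence the exponent [k + k]. *)
Lemma unram_adjoin_sqrt p B t y (N : int) :
  prime p -> odd p -> unram p B -> B (t ^+ 2) -> B y -> y * t ^+ 2 = N%:~R ->
  coprime p `|N| ->
  exists B', [/\ unram p B', B `<=` B' & B' t].
Proof.
move=> pp op [hB BA [k k0 hk]] Bt2 By yt cpN.
pose B' := [set x | exists u v, [/\ B u, B v & x = u + v * t]].
have BB' : B `<=` B'.
  by move=> z Bz; exists z, 0; rewrite mul0r addr0; split=> //; apply: subrg0 hB.
have B't : B' t.
  by exists 0, 1; rewrite mul1r add0r; split=> //; [apply: subrg0 hB|apply: subrg1 hB].
have hB' : subrg B'.
  split; first by apply/BB'; apply: subrg1 hB.
    move=> _ _ [u [v [Bu Bv ->]]] [u' [v' [Bu' Bv' ->]]].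
    exists (u - u'), (v - v'); split; last by ring.
      exact: (subrgB hB).
    exact: (subrgB hB).
  move=> _ _ [u [v [Bu Bv ->]]] [u' [v' [Bu' Bv' ->]]].
  exists (u * u' + v * v' * t ^+ 2), (u * v' + v * u'); split; last by ring.
    exact: (subrgD hB) (subrgM hB Bu Bu') (subrgM hB (subrgM hB Bv Bv') Bt2).
  exact: (subrgD hB) (subrgM hB Bu Bv') (subrgM hB Bv Bu').
have congBB' x z : cong B p x z -> cong B' p x z.
  by case=> w Bw e; exists w => //; apply: BB'.
exists B'; split=> //; split=> //.
  move=> _ [u [v [Bu Bv ->]]]; rewrite rpredD ?rpredM ?(BA _ Bu) ?(BA _ Bv) //.
  by apply: Aint_sqr; apply: BA.
exists (k + k)%N; first by rewrite addn_gt0 k0.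
set q := (p ^ k)%N in hk *.
have oq : odd q by rewrite oddX op orbT.
have hk2 z : B z -> cong B p (z ^+ (p ^ (k + k))) z.
  move=> Bz; rewrite expnD exprM; apply: (cong_trans hB) (hk z Bz).
  by apply: (congX hB) => //; [apply: (subrgX hB)|apply: hk].
pose e := (t ^+ 2) ^+ q./2.
have Be : B e by apply: (subrgX hB).
have tq : t ^+ q = t * e.
  by rewrite /e -exprM -exprS -{1}(odd_double_half q) oq add1n -mul2n.
have e2 : cong B p (e * e) 1.
  have pq : (0 < q)%N by rewrite expn_gt0 prime_gt0.
  have ee : t ^+ 2 * (e * e) = (t ^+ 2) ^+ q.
    rewrite /e -exprD -exprS; congr (_ ^+ _).
    by have := odd_double_half q; rewrite oq -addnn; lia.
  have Bee : B (e * e) by apply: (subrgM hB).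
  (* Multiplication by [y] replaces [t ^+ 2] by the integer [N], which a Bezout relation inverts
     modulo [p]. *)
  have [w Bw Dw] : cong B p (N%:~R * (e * e)) N%:~R.
    by rewrite -yt -mulrA ee; apply: (congMl hB) => //; apply: hk.
  have /coprimezP[[a b] /= Dab] : coprimez p N by rewrite coprimezE.
  have Dab1 : a%:~R * p%:R + b%:~R * N%:~R = 1 :> algC.
    by have := congr1 (intr : int -> algC) Dab; rewrite rmorphD !rmorphM.
  exists (a%:~R * (e * e - 1) + b%:~R * w).
    apply: (subrgD hB); apply: (subrgM hB) => //; try exact: (subrg_int hB).
    exact: (subrgB hB) Bee (subrg1 hB).
  rewrite mulrDr [p%:R * (b%:~R * w)]mulrCA -Dw.
  transitivity ((a%:~R * p%:R + b%:~R * N%:~R) * (e * e - 1)); last by ring.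
  by rewrite Dab1 mul1r.
have ht : cong B' p (t ^+ (p ^ (k + k))) t.
  rewrite expnD exprM -/q tq exprMn tq -[X in cong _ _ _ X]mulr1 -mulrA.
  apply: (congMl hB') => //; apply: (cong_trans hB') (congBB' _ _ e2).
  by apply: (congMl hB'); [apply: BB'|apply/congBB'/hk].
move=> _ [u [v [Bu Bv ->]]].
have Bvt : B' (v * t) by apply: (subrgM hB') => //; apply: BB'.
apply: (cong_trans hB') (cong_expD hB' _ pp (BB' _ Bu) Bvt) _.
apply: (congD hB'); first exact/congBB'/hk2.
rewrite exprMn; apply: (congM hB') => //; first exact: BB'.
  exact: (subrgX hB').
exact/congBB'/hk2.
Qed.

(** Factors ['X] are removed until the constant term [c] is nonzero; then [q = r * 'X + c] gives
    [z * r(z) = - c]. *)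
Lemma algC_int_multiple (q : {poly int}) (z : algC) : q != 0 -> z != 0 ->
  root (map_poly intr q) z ->
  exists (r : {poly int}) (N : int), N != 0 /\ z * (map_poly intr r).[z] = N%:~R.
Proof.
elim/poly_ind: q => [|q c IHq]; rewrite ?eqxx // => q0 z0.
rewrite rmorphD rmorphM /= map_polyX map_polyC /root hornerD hornerM hornerX hornerC.
have [c0|c0] := eqVneq c 0.
  rewrite c0 raddf0 addr0 mulf_eq0 (negbTE z0) orbF; apply: IHq => //.
  by apply: contra q0 => /eqP ->; rewrite c0 polyC0 mul0r addr0.
rewrite addr_eq0 => /eqP e; exists q, (- c); split; first by rewrite oppr_eq0.
by rewrite mulrC e mulrNz.
Qed.

(** Passage from the order to its fraction field: every element of [gen X] falls into [B] after
    multiplication by a nonzero integer [M], which changes [N] by the square [M ^+ 2] only. *)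
Lemma unram_frac p (B X : set algC) y (N : int) :
  prime p -> unram p B -> X `<=` B -> gen X y -> y ^+ 2 = N%:~R -> N != 0 ->
  ~~ odd (logn p `|N|).
Proof.
move=> pp uB XB Xy y2 N0; have [hB BA _] := uB.
pose T := [set x | exists2 M : int, M != 0 & B (M%:~R * x)].
have TM x z : T x -> T z -> T (x * z).
  move=> [M M0 BM] [M' M'0 BM']; exists (M * M'); first by rewrite mulf_neq0.
  by rewrite rmorphM mulrACA; apply: (subrgM hB).
have BT : B `<=` T by move=> z Bz; exists 1; rewrite ?mul1r.
(* An integer multiple of [z^-1] is a polynomial in [z] with integer coefficients, because [z] is
   integral. *)
have TV x : T x -> T x^-1.
  have [->|x0] := eqVneq x 0; first by rewrite invr0.
  move=> [M M0 BM]; set z := M%:~R * x in BM.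
  have z0 : z != 0 by rewrite mulf_neq0 // intr_eq0.
  have /floorpP[q Dq] := BA _ BM.
  have [||r [M' [M'0 DM']]] := @algC_int_multiple q z _ z0.
  - apply: contraTneq (root_minCpoly z) => q0.
    have := minCpoly_eq0 z; rewrite Dq q0 rmorph0 eqxx //.
  - by rewrite -Dq root_minCpoly.
  exists M' => //; rewrite -DM' mulrAC [X in X * _](_ : _ = M%:~R); last by rewrite mulfK.
  apply: (subrgM hB); first exact: (subrg_int hB).
  rewrite horner_coef; apply: (subrg_sum hB) => i _.
  by rewrite coef_map; apply: (subrgM hB); [apply: (subrg_int hB)|apply: (subrgX hB)].
have [M M0 BMy] : T y.
  apply: (@gen_min X T) => // [|x Xx]; last exact/BT/XB.
  apply/subfldP; split; first by apply: BT; apply: subrg1 hB.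
    move=> x z [M M0 BM] [M' M'0 BM']; exists (M * M'); first by rewrite mulf_neq0.
    rewrite mulrBr rmorphM; apply: (subrgB hB).
      by rewrite mulrAC mulrC; apply: (subrgM hB) => //; apply: (subrg_int hB).
    by rewrite -mulrA; apply: (subrgM hB) => //; apply: (subrg_int hB).
  by move=> x z Tx Tz; apply: TM => //; apply: TV.
have := @unram_sqr_even p B (M%:~R * y) (M ^+ 2 * N) pp uB BMy.
rewrite exprMn y2 rmorphM rmorphXn mulf_neq0 ?expf_neq0 // abszM abszX.
rewrite lognM ?expn_gt0 ?absz_gt0 ?M0 // lognX oddD oddM /=.
by apply.
Qed.

(** * The tree of preimages *)

Definition quadmap (R : nzRingType) (g c x : R) : R := (x - g) ^+ 2 + c.

(** The orbit starts at the critical point [g] itself, so [crit g c 1] is [c]. *)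
Definition crit (g c : int) (n : nat) : int := iter n (quadmap g c) g.

Fixpoint words (n : nat) : seq (seq bool) :=
  if n is n'.+1 then
    [seq false :: w | w <- words n'] ++ [seq true :: w | w <- words n']
  else [:: [::]].

Lemma mem_words n w : (w \in words n) = (size w == n).
Proof.
elim: n w => [|n IHn] w; first by rewrite /= inE; case: w.
rewrite /= mem_cat; apply/orP/eqP => [[] /mapP[u]|].
- by rewrite IHn => /eqP <- ->.
- by rewrite IHn => /eqP <- ->.
case: w => [|[] w] //= [sw]; [right|left]; apply/map_f; by rewrite IHn sw.
Qed.

Lemma words_uniq n : uniq (words n).
Proof.
elim: n => [|n IHn] //=; rewrite cat_uniq !map_inj_uniq ?IHn ?andbT //=; last 2 first.
- by move=> u v [].
- by move=> u v [].
by apply/hasPn => w /mapP[u _ ->]; apply/mapP => -[].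
Qed.

Lemma size_words n : size (words n) = (2 ^ n)%N.
Proof.
by elim: n => [|n IHn] //=; rewrite size_cat !size_map IHn addnn -mul2n expnS.
Qed.

Lemma rmorph_quadmap (R S : nzRingType) (f : {rmorphism R -> S}) g c x :
  f (quadmap g c x) = quadmap (f g) (f c) (f x).
Proof. by rewrite /quadmap rmorphD rmorphXn rmorphB. Qed.

Lemma rmorph_iter_quadmap (R S : nzRingType) (f : {rmorphism R -> S}) g c n x :
  f (iter n (quadmap g c) x) = iter n (quadmap (f g) (f c)) (f x).
Proof. by elim: n => //= n <-; rewrite rmorph_quadmap. Qed.

Lemma prodrN_seq (R : comNzRingType) (I : Type) (s : seq I) (F : I -> R) :
  \prod_(i <- s) - F i = (-1) ^+ size s * \prod_(i <- s) F i.
Proof.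
elim: s => [|i s IHs]; first by rewrite !big_nil mul1r.
by rewrite !big_cons IHs /= exprS; ring.
Qed.

(* [l] names the iterated preimages of 0, a word being a child of its tail;
   siblings are allowed to coincide. *)
Record preimage_tree (g c : int) (l : seq bool -> algC) : Prop := PreimageTree {
  pt_root : l [::] = 0;
  pt_parent : forall b w, quadmap g%:~R c%:~R (l (b :: w)) = l w;
  pt_sibling : forall w, l (true :: w) = 2 * g%:~R - l (false :: w) }.

Section PreimageTree.
Variables (g c : int) (l : seq bool -> algC).
Hypothesis lT : preimage_tree g c l.
Let Q : algC -> algC := quadmap g%:~R c%:~R.

(** The factors of two siblings multiply to [Q z - l w], so the product over level [n + 1] at [z] is
    the product over level [n] at [Q z]. *)
Lemma iter_quadmap_prod n z :
  iter n Q z = \prod_(w <- words n) (z - l w).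
Proof.
elim: n z => [|n IHn] z; first by rewrite big_seq1 (pt_root lT) subr0.
rewrite iterSr IHn /= big_cat !big_map /= -big_split /=; apply: eq_bigr => w _.
by rewrite -(pt_parent lT false w) (pt_sibling lT) /Q /quadmap; ring.
Qed.

Lemma crit_prod n :
  (crit g c n.+1)%:~R = \prod_(w <- words n) (c%:~R - l w).
Proof.
rewrite -iter_quadmap_prod /crit rmorph_iter_quadmap iterSr.
by rewrite {2}/quadmap subrr expr0n add0r.
Qed.

Lemma tree_preimageP n z :
  iter n Q z = 0 <-> exists2 w, size w = n & z = l w.
Proof.
rewrite iter_quadmap_prod; split=> [/eqP|[w sw ->]].
  rewrite prodf_seq_eq0 => /hasP[w /=].
  by rewrite mem_words subr_eq0 => /eqP sw /eqP ->; exists w.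
apply/eqP; rewrite prodf_seq_eq0; apply/hasP; exists w; rewrite ?mem_words ?sw //=.
by rewrite subrr.
Qed.

Definition tree_field (n : nat) : set algC := gen [set` [seq l w | w <- words n]].

Lemma tree_field_subfld n : subfld (tree_field n).
Proof. exact: gen_subfld. Qed.

(** Every label is the image under the quadratic map of the label of a child, so the generators at
    level [n] give all lower levels. *)
Lemma tree_field_label n w : (size w <= n)%N -> tree_field n (l w).
Proof.
move=> sw; have [m Dm] : exists m, n = (m + size w)%N by exists (n - size w)%N; lia.
elim: m w Dm {sw} => [|m IHm] w Dm.
  by apply: sub_gen; rewrite /= map_f // mem_words Dm.
have hK := tree_field_subfld n.
rewrite -(pt_parent lT false w); apply: (subfldD hK); last exact: subfld_int hK _.
apply: (subfldX hK); apply: (subfldB hK); last exact: subfld_int hK _.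
by apply: IHm; rewrite /= Dm; lia.
Qed.

Lemma tree_fieldS m n : (m <= n)%N -> tree_field m `<=` tree_field n.
Proof.
move=> mn; apply: genS => z /= /mapP[w].
by rewrite mem_words => /eqP sw ->; apply: tree_field_label; rewrite sw.
Qed.

Lemma aut_label (nu : {rmorphism algC -> algC}) w :
  exists2 w', size w' = size w & nu (l w) = l w'.
Proof.
apply/tree_preimageP; have : iter (size w) Q (l w) = 0.
  by apply/tree_preimageP; exists w.
move/(congr1 nu); rewrite rmorph0 => <-.
by rewrite /Q rmorph_iter_quadmap !rmorph_int.
Qed.

Lemma aut_tree_field (nu : {rmorphism algC -> algC}) n z :
  tree_field n z -> tree_field n (nu z).
Proof.
apply: gen_morph => x /= /mapP[w]; rewrite mem_words => /eqP sw ->.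
by have [w' sw' ->] := aut_label nu w; apply: tree_field_label; rewrite sw' sw.
Qed.

Lemma aut_tree_fieldV (nu : {rmorphism algC -> algC}) n z :
  tree_field n (nu z) -> tree_field n z.
Proof. by move/(@aut_tree_field (algC_invaut nu) n); rewrite /= algC_autK. Qed.

Definition crit_nz (n : nat) : Prop := forall j, (0 < j <= n)%N -> crit g c j != 0.

(** Equal siblings are both [g], so their parent is [c] and contributes a zero factor to
    [crit_prod]. *)
Lemma sibling_neq w : crit g c (size w).+1 != 0 -> l (true :: w) != l (false :: w).
Proof.
apply: contra => /eqP e; rewrite -(intr_eq0 algC) crit_prod prodf_seq_eq0.
apply/hasP; exists w; rewrite ?mem_words //= -(pt_parent lT false w) /quadmap.
have -> : l (false :: w) = g%:~R.
  apply: (@mulfI _ 2); rewrite ?pnatr_eq0 //.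
  by rewrite mulr_natl mulr2n -{1}e (pt_sibling lT) subrK.
by rewrite subrr expr0n add0r subrr.
Qed.

Lemma label_inj n : crit_nz n ->
  forall w w', (size w <= n)%N -> size w = size w' -> l w = l w' -> w = w'.
Proof.
move=> cn; elim=> [|b w IHw] [|b' w'] //= sw [sww'] e.
have eQ : w = w'.
  by apply: IHw => //; [apply: ltnW|rewrite -(pt_parent lT b w) e (pt_parent lT)].
rewrite -eQ in e *; congr (_ :: _).
have := @sibling_neq w (cn _ _); rewrite sw => /(_ isT).
by case: b b' e => -[] // ->; rewrite eqxx.
Qed.

(** A partial converse of [sibling_neq]: a zero factor in [crit_prod] is a vertex labelled [c], both
    of whose children are labelled [g]. *)
Lemma crit_nz_label n : (0 < n)%N ->
  (forall w w', size w = n -> size w' = n -> l w = l w' -> w = w') ->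
  crit g c n != 0.
Proof.
case: n => // n _ inj; apply/negP; rewrite -(intr_eq0 algC) crit_prod.
rewrite prodf_seq_eq0 => /hasP[w]; rewrite mem_words => /eqP sw /=.
rewrite subr_eq0 -(pt_parent lT false w) /quadmap eq_sym -subr_eq0 addrK.
rewrite expf_eq0 /= subr_eq0 => /eqP e.
have : true :: w = false :: w; last by [].
by apply: inj; rewrite /= ?sw // (pt_sibling lT) e; ring.
Qed.

(** The tree is climbed by adjoining the roots of [l w - c] one by one. Up to sign these numbers
    multiply to the next critical value, which is prime to [p], so each of them divides an integer
    prime to [p]. *)
Lemma tree_unram p n : prime p -> odd p ->
  (forall j, (0 < j <= n)%N -> ~~ (p %| `|crit g c j|)%N) ->
  exists2 B, unram p B & forall w, (size w <= n)%N -> B (l w).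
Proof.
move=> pp op; elim: n => [|n IHn] hp.
  exists [set x | exists z : int, x = z%:~R]; first exact: unram_int.
  by case=> // _; rewrite (pt_root lT); exists 0.
have [|B uB Bl] := IHn; first by move=> j /andP[j0 jn]; rewrite hp // j0 leqW.
pose t w := l (false :: w) - g%:~R.
have t2 w : t w ^+ 2 = l w - c%:~R.
  by rewrite -(pt_parent lT false w) /quadmap addrK.
have adj (ws : seq (seq bool)) : {subset ws <= words n} ->
    exists B', [/\ unram p B', B `<=` B' & forall w, w \in ws -> B' (t w)].
  elim: ws => [|w ws IHws] sub; first by exists B; split.
  have [|B' [uB' BB' B't]] := IHws.
    by move=> u hu; apply: sub; rewrite inE hu orbT.
  have hB' : subrg B' by case: uB'.
  have wn : w \in words n by apply: sub; rewrite mem_head.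
  have Bt2 u : u \in words n -> B' (t u ^+ 2).
    rewrite mem_words => /eqP su; rewrite t2; apply: (subrgB hB').
      by apply/BB'/Bl; rewrite su.
    exact: (subrg_int hB').
  (* The cofactor of [t w ^+ 2] is the product of the squares for all other words of the level. *)
  have [|||B2 [uB2 sB2 B2t]] := @unram_adjoin_sqrt p B' (t w)
    (\prod_(u <- rem w (words n)) t u ^+ 2)
    ((-1) ^+ size (words n) * crit g c n.+1) pp op uB' (Bt2 w wn).
  - rewrite big_seq; apply: (subrg_prod hB') => u hu; apply: Bt2.
    exact: (mem_rem hu).
  - transitivity (\prod_(u <- words n) t u ^+ 2).
      by rewrite (big_rem w wn) mulrC.
    rewrite intrM rmorphXn rmorphN1 crit_prod.
    rewrite -prodrN_seq; apply: eq_bigr => u _; by rewrite t2 opprB.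
  - rewrite abszM abszX abszN1 exp1n mul1n prime_coprime //; apply: hp.
    by rewrite leqnn.
  exists B2; split=> //; first by apply: subset_trans BB' sB2.
  move=> u; rewrite inE => /orP[/eqP -> //|hu]; apply: sB2.
  exact: B't.
have [|B' [uB' BB' B't]] := adj (words n); first by [].
exists B' => // u su; have hB' : subrg B' by case: uB'.
have [un|un] := leqP (size u) n; first exact/BB'/Bl.
have {su un} : size u = n.+1 by apply/eqP; rewrite eqn_leq su.
case: u => [//|b w] [sw].
have Btw : B' (l (false :: w)).
  rewrite -[l _](subrK g%:~R); apply: (subrgD hB') (subrg_int hB' g).
  by apply: B't; rewrite mem_words sw.
case: b => //; rewrite (pt_sibling lT); apply: (subrgB hB') => //.
exact: (subrgM hB') (subrg_nat hB' 2) (subrg_int hB' _).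
Qed.

Lemma tree_field_sqr_even p n y (N : int) : prime p -> odd p ->
  (forall j, (0 < j <= n)%N -> ~~ (p %| `|crit g c j|)%N) ->
  tree_field n y -> y ^+ 2 = N%:~R -> N != 0 -> ~~ odd (logn p `|N|).
Proof.
move=> pp op hp; have [B uB Bl] := tree_unram pp op hp.
apply: (unram_frac pp uB) => z /= /mapP[w].
by rewrite mem_words => /eqP sw ->; apply: Bl; rewrite sw.
Qed.

Definition tree_transitive (n : nat) : Prop :=
  forall w w', size w = n -> size w' = n ->
    exists nu : {rmorphism algC -> algC}, nu (l w) = l w'.

Let t w := l (false :: w) - g%:~R.

Lemma sqrt_label w : t w ^+ 2 = l w - c%:~R.
Proof. by rewrite -(pt_parent lT false w) /quadmap addrK. Qed.

Lemma aut_sqrt (nu : {rmorphism algC -> algC}) w w' :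
  nu (l w) = l w' -> nu (t w) = t w' \/ nu (t w) = - t w'.
Proof.
move=> e; have : nu (t w) ^+ 2 = t w' ^+ 2.
  by rewrite -rmorphXn !sqrt_label rmorphB e rmorph_int.
by move/eqP; rewrite eqf_sqr => /orP[] /eqP; [left|right].
Qed.

Let prodJ n (J : seq bool -> bool) := \prod_(w <- words n | J w) t w.

(** The subsets [J] whose product lies in [tree_field n] form a Galois-stable space over F_2. If it
    were nonzero, [transitive_all_ones] would put the whole level in it, and the square of that
    product is the next critical value. *)
Lemma sqrt_independent n (J : seq bool -> bool) : (0 < n)%N ->
  crit_nz n -> tree_transitive n ->
  (forall y, tree_field n y -> y ^+ 2 != (crit g c n.+1)%:~R) ->
  (exists2 w, size w = n & J w) -> ~ tree_field n (prodJ n J).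
Proof.
move=> n0 cn tr nsq Jw KJ; have hK := tree_field_subfld n.
have Kt2 w : w \in words n -> tree_field n (t w ^+ 2).
  rewrite mem_words => /eqP sw; rewrite sqrt_label.
  apply: (subfldB hK) (subfld_int hK c).
  by apply: tree_field_label; rewrite sw.
pose G := [set s : seq bool -> seq bool | exists nu : {rmorphism algC -> algC},
  forall w, (size w <= n)%N -> size (s w) = size w /\ nu (l w) = l (s w)].
have linj := label_inj cn.
(* A vanishing [t w] would make the critical value 0, the square of 0. *)
have t0 w : w \in words n -> t w != 0.
  rewrite -sqrf_eq0 sqrt_label => wn; apply/negP; rewrite subr_eq0 => /eqP e.
  have := nsq 0 (subfld0 hK); rewrite expr0n crit_prod eq_sym prodf_seq_eq0.
  by move/hasP; apply; exists w => //=; rewrite e subrr.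
have Gtree s : G s -> [/\ forall w, size w <= n -> size (s w) = size w,
     forall w, size w <= n -> s (behead w) = behead (s w) &
     {in [pred w | size w <= n] &, injective s}]%N.
  move=> [nu hnu]; split=> [w sw|w sw|w w' sw sw' e].
  - by have [] := hnu w sw.
  - have [s1 e1] := hnu _ sw; case: w sw s1 e1 => [|b w] sw s1 e1.
      by move: s1; case: (s [::]).
    have [s2 e2] := hnu w (ltnW sw).
    apply: linj; rewrite /= ?size_behead ?s1 ?s2 //; first exact: ltnW.
    rewrite -e2 -(pt_parent lT b w) rmorph_quadmap e1 !rmorph_int.
    by case: (s (b :: w)) s1 => //= b' v _; rewrite (pt_parent lT).
  - have [s1 e1] := hnu w sw; have [s2 e2] := hnu w' sw'.
    apply: linj => //; first by rewrite -s1 e s2.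
    by apply: (fmorph_inj nu); rewrite e1 e2 e.
have [|||||J' KJ' J'1] := @transitive_all_ones n [set J | tree_field n (prodJ n J)] G.
(* The product over a symmetric difference is the product of both, divided by the squares over the
   intersection. *)
- move=> J1 J2 /= K1 K2.
  have e : prodJ n (fun w => J1 w (+) J2 w) *
      \prod_(w <- words n | J1 w && J2 w) t w ^+ 2 = prodJ n J1 * prodJ n J2.
    rewrite /prodJ [in LHS]big_mkcond [X in _ * X]big_mkcond [in RHS]big_mkcond.
    rewrite [X in _ = _ * X]big_mkcond -!big_split /=; apply: eq_bigr => w _.
    by case: (J1 w) (J2 w) => -[] /=; rewrite ?mul1r ?mulr1 ?expr2.
  have d0 : \prod_(w <- words n | J1 w && J2 w) t w ^+ 2 != 0.
    rewrite prodf_seq_neq0; apply/allP => w wn; apply/implyP => _.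
    by rewrite expf_neq0 ?t0.
  rewrite -[prodJ n _](mulfK d0) e; apply: (subfld_div hK) (subfldM hK K1 K2) _.
  by rewrite big_seq_cond; apply: (subfld_prod hK) => w /andP[wn _]; apply: Kt2.
- move=> s J1 [nu hnu] /= K1; apply: (@aut_tree_fieldV nu).
  have Gs : G s by exists nu.
  have [s1 _ s3] := Gtree s Gs.
  have sP w : w \in words n -> s w \in words n.
    by rewrite !mem_words => /eqP sw; rewrite s1 ?sw.
  rewrite /prodJ rmorph_prod /= big_seq_cond.
  (* Each ratio [nu (t w) / t (s w)] is a sign, hence in the field, and [s] permutes the level. *)
  rewrite (eq_bigr (fun w => nu (t w) / t (s w) * t (s w))); last first.
    by move=> w /andP[wn _]; rewrite divfK // t0 // sP.
  rewrite big_split /=; apply: (subfldM hK).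
    apply: (subfld_prod hK) => w /andP[wn _].
    have ts0 : t (s w) != 0 by rewrite t0 // sP.
    have [_ e] : size (s w) = size w /\ nu (l w) = l (s w).
      by apply: hnu; move: wn; rewrite mem_words => /eqP ->.
    have [->|->] := aut_sqrt e; first by rewrite divff //; apply: subfld1 hK.
    by rewrite mulNr divff //; apply: (subfldN hK); apply: subfld1 hK.
  rewrite -big_seq_cond -(big_map s J1 t) (perm_big (words n)) //.
  have us : uniq (map s (words n)).
    rewrite map_inj_in_uniq ?words_uniq // => u v; rewrite !mem_words => /eqP su /eqP sv.
    by apply: s3; rewrite inE ?su ?sv.
  apply: uniq_perm; rewrite ?words_uniq //.
  have ss : {subset map s (words n) <= words n}.
    by move=> _ /mapP[u un ->]; apply: sP.
  by have [] := uniq_min_size us ss; rewrite ?size_map.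
- exact: Gtree.
- move=> w w' sw sw'; have [nu e] := tr w w' sw sw'.
  have /choice[s hs] : forall w, exists w', size w' = size w /\ nu (l w) = l w'.
    by move=> u; have [u' ? ?] := aut_label nu u; exists u'.
  exists s; first by exists nu.
  have [s1 e1] := hs w; apply: linj; rewrite ?s1 ?sw ?sw' //.
  by rewrite -e1.
- by exists J.
have := nsq _ KJ'; rewrite /prodJ -prodrXl crit_prod.
have -> : \prod_(w <- words n | J' w) t w ^+ 2 = \prod_(w <- words n) t w ^+ 2.
  rewrite [RHS]big_seq [LHS]big_seq_cond; apply: eq_bigl => w.
  by rewrite andb_idr // mem_words => /eqP/J'1.
rewrite (eq_bigr (fun w => - (c%:~R - l w))) => [|w _]; last first.
  by rewrite sqrt_label opprB.
(* The sign is trivial because level [n] has an even number of vertices when [n] is positive. *)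
rewrite prodrN_seq size_words -signr_odd oddX /= (gtn_eqF n0) expr0 mul1r.
by rewrite eqxx.
Qed.

(** By Kummer independence, [t w0] is not in the field generated by [tree_field n] and the other
    square roots; an automorphism over that field moving it must change its sign. *)
Lemma sqrt_flip n w0 : (0 < n)%N ->
  crit_nz n -> tree_transitive n ->
  (forall y, tree_field n y -> y ^+ 2 != (crit g c n.+1)%:~R) ->
  size w0 = n ->
  exists nu : {rmorphism algC -> algC},
    [/\ forall x, tree_field n x -> nu x = x, nu (t w0) = - t w0 &
        forall w, size w = n -> w != w0 -> nu (t w) = t w].
Proof.
move=> n0 cn tr nsq sw0; have hK := tree_field_subfld n.
have w0n : w0 \in words n by rewrite mem_words sw0.
pose ws := rem w0 (words n).
have uws : uniq (rcons ws w0).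
  by rewrite rcons_uniq rem_uniq ?words_uniq // mem_rem_uniqF ?words_uniq.
have sub : {subset rcons ws w0 <= words n}.
  by move=> w; rewrite mem_rcons inE => /orP[/eqP ->//|/mem_rem].
have Nt0 : ~ gen (tree_field n `|` [set` map t ws]) (t w0).
  apply: (kummer_independent hK).
    move=> x; rewrite -map_rcons => /mapP[w /sub]; rewrite mem_words => /eqP sw ->.
    rewrite sqrt_label; apply: (subfldB hK) (subfld_int hK c).
    by apply: tree_field_label; rewrite sw.
  move=> r; rewrite -map_rcons => /subseqP[m sm ->]; rewrite -map_mask big_map.
  set us := mask m (rcons ws w0) => us0.
  have sus : {subset us <= words n} by move=> w /mem_mask/sub.
  have -> : \prod_(w <- us) t w = prodJ n (mem us).
    rewrite /prodJ -[RHS]big_filter; apply: perm_big; apply: uniq_perm.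
    - exact: mask_uniq.
    - by rewrite filter_uniq ?words_uniq.
    by move=> w; rewrite mem_filter inE; case: (boolP (w \in us)) => // /sus.
  apply: sqrt_independent => //.
  case: (us) us0 sus => // w us' _ sus; exists w; last by rewrite inE mem_head.
  by apply/eqP; rewrite -mem_words sus ?mem_head.
(* The base field is presented by a finite list: the labels of level [n] and the remaining square
   roots. *)
have [|nu [nu1 nu2]] := @gen_galois_moves (map l (words n) ++ map t ws) (t w0).
  move=> h; apply: Nt0; apply: genS h => z /=; rewrite mem_cat => /orP[hz|hz].
    by apply: sub_gen; left; apply: sub_gen.
  by apply: sub_gen; right.
have fixK x : tree_field n x -> nu x = x.
  move=> Kx; apply: nu1; apply: genS Kx => z /= hz.
  by apply: sub_gen; rewrite /= mem_cat hz.
exists nu; split=> // [|w sw ww0].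
  have [||//] := @aut_sqrt nu w0 w0; last by move/nu2.
  by apply: fixK; apply: tree_field_label; rewrite sw0.
apply: nu1; apply: sub_gen; rewrite /= mem_cat (map_f t) ?orbT //.
by rewrite /ws mem_rem_uniq ?words_uniq // !inE ww0 mem_words sw eqxx.
Qed.

(** Galois realizes the whole kernel of the restriction from level [n + 1] to level [n]: single sign
    changes are composed over the words selected by [eps]. *)
Lemma sibling_flips n (eps : seq bool -> bool) : (0 < n)%N ->
  crit_nz n -> tree_transitive n ->
  (forall y, tree_field n y -> y ^+ 2 != (crit g c n.+1)%:~R) ->
  exists nu : {rmorphism algC -> algC},
    (forall x, tree_field n x -> nu x = x) /\
    forall b w, size w = n -> nu (l (b :: w)) = l (b (+) eps w :: w).
Proof.
move=> n0 cn tr nsq.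
suff [nu [nu1 nu2]] : exists nu : {rmorphism algC -> algC},
    (forall x, tree_field n x -> nu x = x) /\
    forall w, size w = n -> nu (t w) = (-1) ^+ (w \in [seq u <- words n | eps u]) * t w.
  exists nu; split=> // b w sw; have := nu2 w sw.
  rewrite mem_filter mem_words sw eqxx andbT rmorphB rmorph_int => /eqP.
  rewrite subr_eq => /eqP nuf.
  have nuf' : nu (l (false :: w)) = l (eps w :: w).
    rewrite nuf /t; case: (eps w); rewrite ?mul1r ?subrK // (pt_sibling lT); ring.
  case: b => //; rewrite (pt_sibling lT) rmorphB rmorphM rmorph_nat rmorph_int nuf'.
  by case: (eps w) => /=; rewrite (pt_sibling lT) //; ring.
have : {subset [seq u <- words n | eps u] <= words n}.
  by move=> u; rewrite mem_filter => /andP[].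
have : uniq [seq u <- words n | eps u] by rewrite filter_uniq ?words_uniq.
elim: [seq u <- words n | eps u] => [|u us IHus] /=.
  by exists idfun; split=> // w _; rewrite mul1r.
move=> /andP[uus uniqus] sub.
have [|nu [nu1 nu2]] := IHus uniqus.
  by move=> v hv; apply: sub; rewrite inE hv orbT.
have su : size u = n by apply/eqP; rewrite -mem_words sub ?mem_head.
have [mu [mu1 mu2 mu3]] := sqrt_flip n0 cn tr nsq su.
exists (mu \o nu); split=> [x Kx|w sw] /=; first by rewrite nu1 ?mu1.
rewrite nu2 // rmorphM rmorphXn rmorphN1 inE; have [->|ne] := eqVneq w u.
  by rewrite (negbTE uus) mu2 //= mul1r expr1 mulN1r.
by rewrite mu3.
Qed.

(** An automorphism matches the parents, and flipping all sibling pairs, if necessary, then matches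
    the children. *)
Lemma tree_transitiveS n : (0 < n)%N ->
  crit_nz n -> tree_transitive n ->
  (forall y, tree_field n y -> y ^+ 2 != (crit g c n.+1)%:~R) ->
  tree_transitive n.+1.
Proof.
move=> n0 cn tr nsq [//|b w] [//|b' w'] [sw] [sw'].
have [nu e] := tr w w' sw sw'.
have [[//|b1 w1] [s1] e1] := aut_label nu (b :: w).
have ew1 : w1 = w'.
  apply: (label_inj cn); rewrite ?s1 ?sw ?sw' //.
  rewrite -(pt_parent lT b1 w1) -e1 -e -(pt_parent lT b w) rmorph_quadmap.
  by rewrite !rmorph_int.
have [mu [_ mu2]] := sibling_flips (fun _ => b1 (+) b') n0 cn tr nsq.
exists (mu \o nu); rewrite /= e1 ew1 mu2 //.
by rewrite addbA addbb addFb.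
Qed.

End PreimageTree.

(** * Arboreal images *)

Definition qpoly (g c : int) : {poly rat} := map_poly intr (quad g c).

Lemma map_iterate_qpoly g c n :
  map_poly ratr (iterate (qpoly g c) n) =
  iter n (quadmap (g%:~R)%:P (c%:~R)%:P) 'X :> {poly algC}.
Proof.
elim: n => [|n IHn]; first by rewrite map_polyX.
have -> : iterate (qpoly g c) n.+1 = qpoly g c \Po iterate (qpoly g c) n by [].
rewrite map_comp_poly IHn /= /quadmap /qpoly /quad.
rewrite rmorphD rmorphXn rmorphB /= map_polyX !map_polyC /=.
rewrite rmorphD rmorphXn rmorphB /= map_polyX !map_polyC /=.
by rewrite !ratr_int comp_polyD rmorphXn /= comp_polyB comp_polyX !comp_polyC.
Qed.

Lemma horner_iterate_qpoly g c n z :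
  (map_poly ratr (iterate (qpoly g c) n) : {poly algC}).[z] =
  iter n (quadmap g%:~R c%:~R) z.
Proof.
rewrite map_iterate_qpoly; elim: n => [|n IHn] /=; first by rewrite hornerX.
by rewrite /quadmap hornerD !hornerC horner_exp hornerD hornerN hornerC IHn.
Qed.

Lemma horner_qpoly g c z :
  (map_poly ratr (qpoly g c) : {poly algC}).[z] = quadmap g%:~R c%:~R z.
Proof. by have := horner_iterate_qpoly g c 1 z; rewrite /iterate /= comp_polyXr. Qed.

Lemma tree_aut_size s : tree_aut tree_infty s -> forall w, size (s w) = size w.
Proof.
move=> [[_ sinj _] sb].
have s0 : s [::] = [::].
  have := sb [::] I; rewrite /=; case: (s [::]) => //= b u /(congr1 size) /=; lia.
elim=> [|b w IHw]; first by rewrite s0.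
have := sb (b :: w) I; rewrite /= => e; move: IHw; rewrite e.
case E : (s (b :: w)) => [|b' u] /=; last by move=> ->.
have : b :: w = [::]; last by [].
by apply: sinj; rewrite ?inE // E s0.
Qed.

Section Arboreal.
Variables (g c : int) (l : seq bool -> algC).
Hypothesis lT : preimage_tree g c l.
Let f : {poly rat} := qpoly g c.

Lemma map_iterate_prod n :
  map_poly ratr (iterate f n) = \prod_(w <- words n) ('X - (l w)%:P).
Proof.
rewrite map_iterate_qpoly; elim: n 'X => [|n IHn] z.
  by rewrite big_seq1 (pt_root lT) subr0.
rewrite iterSr IHn /= big_cat !big_map /= -big_split /=; apply: eq_bigr => w _.
rewrite -(pt_parent lT false w) (pt_sibling lT) /quadmap.
rewrite !(rmorphD, rmorphN, rmorphM, rmorphXn, rmorph_nat) /=; ring.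
Qed.

Lemma preimagesE n : preimages f n = [set` map l (words n)].
Proof.
have E : map_poly ratr (iterate f n) =
    \prod_(x <- map l (words n)) ('X - x%:P) by rewrite map_iterate_prod big_map.
by apply/seteqP; split=> z; rewrite /preimages /= E root_prod_XsubC.
Qed.

Lemma splittingE n : splitting f n = tree_field l n.
Proof. by rewrite /splitting preimagesE. Qed.

Lemma crit_nz_separable n : crit_nz g c n -> separable_poly (iterate f n).
Proof.
move=> cn; rewrite -(separable_map (ratr : {rmorphism rat -> algC})).
rewrite map_iterate_prod -(big_map l xpredT (fun x => 'X - x%:P)).
rewrite separable_prod_XsubC map_inj_in_uniq ?words_uniq // => u v.
rewrite !mem_words => /eqP su /eqP sv.
by apply: (label_inj lT cn); rewrite ?su.
Qed.

Lemma tree_labelling n (V : set (seq bool)) : crit_nz g c n ->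
  (forall w, V w -> size w <= n)%N -> labelling f V l.
Proof.
move=> cn Vn w Vw; split.
  rewrite preimagesE; split.
  - by move=> u /= su; rewrite map_f // mem_words su.
  - move=> u v; rewrite !inE => su sv.
    by apply: (label_inj lT cn); rewrite ?su ?Vn.
  - by move=> z /= /mapP[u]; rewrite mem_words => /eqP su ->; exists u.
by case: w Vw => // b w _ _; rewrite horner_qpoly (pt_parent lT).
Qed.

Definition flippable (n : nat) : Prop := forall eps : seq bool -> bool,
  exists nu : {rmorphism algC -> algC},
    (forall x, tree_field l n x -> nu x = x) /\
    forall b w, size w = n -> nu (l (b :: w)) = l (b (+) eps w :: w).

(** Level by level, an automorphism agreeing with [s] up to level [m] is corrected by a flip below
    the vertices where the two disagree. *)
Lemma flippable_lift n0 s (nu0 : {rmorphism algC -> algC}) :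
  (forall n, crit_nz g c n) -> (forall n, (n0 <= n)%N -> flippable n) ->
  tree_aut tree_infty s ->
  (forall w, (size w <= n0)%N -> l (s w) = nu0 (l w)) ->
  forall n, exists nu : {rmorphism algC -> algC},
    forall w, (size w <= n)%N -> l (s w) = nu (l w).
Proof.
move=> cn fl sT hnu0 n; have sz := tree_aut_size sT.
have [[_ sinj _] sb] := sT.
have [nn0|nn0] := leqP n n0.
  by exists nu0 => w sw; apply: hnu0; apply: leq_trans nn0.
have {nn0} -> : n = (n0 + (n - n0))%N by lia.
elim: (n - n0)%N => [|k [nu hnu]]; first by exists nu0; rewrite addn0.
set m := (n0 + k)%N in hnu *.
(* Comparing first children is enough: [s] and [nu] both send a sibling pair onto the same sibling
   pair. *)
pose eps w := l (s (false :: w)) != nu (l (false :: w)).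
have [|mu [mu1 mu2]] := fl m _ eps; first exact: leq_addr.
exists (nu \o mu) => w; rewrite addnS -/m => sw /=.
have [wm|wm] := leqP (size w) m.
  by rewrite mu1 ?hnu //; apply: (tree_field_label lT).
have {sw wm} : size w = m.+1 by apply/eqP; rewrite eqn_leq sw.
case: w => [//|b w] [sw]; rewrite mu2 //.
have scons b1 : exists b2, s (b1 :: w) = b2 :: s w.
  have := sb (b1 :: w) I; have := sz (b1 :: w).
  by case: (s (b1 :: w)) => [|b2 u] //= _ ->; exists b2.
have [b1 e1] := scons false; have [b2 e2] := scons true.
have b12 : b2 = ~~ b1.
  suff : b1 != b2 by case: (b1) (b2) => -[].
  apply/eqP => E; have : false :: w = true :: w; last by [].
  by apply: sinj; rewrite ?inE // e1 e2 E.
have [[//|b3 w3] [s3] e3] := aut_label lT nu (false :: w).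
have ew : w3 = s w.
  apply: (label_inj lT (cn m)); rewrite ?sz ?s3 ?sw //.
  rewrite -(pt_parent lT b3 w3) -e3 hnu ?sw //.
  by rewrite -[in RHS](pt_parent lT false w) rmorph_quadmap !rmorph_int.
rewrite ew in e3.
have e4 : nu (l (true :: w)) = l (~~ b3 :: s w).
  rewrite (pt_sibling lT) rmorphB rmorphM rmorph_nat rmorph_int e3.
  by case: (b3) => /=; rewrite (pt_sibling lT) //; ring.
have linj1 (x y : bool) : (l (x :: s w) == l (y :: s w)) = (x == y).
  apply/eqP/eqP => [|-> //] /(label_inj lT (cn m.+1)).
  by rewrite /= sz sw => /(_ (leqnn _) erefl) [].
have heps : eps w = (b1 != b3) by rewrite /eps e1 e3 linj1.
have nuE x : nu (l (x :: w)) = l (x (+) b3 :: s w) by case: x; rewrite ?e3 ?e4.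
have sE x : s (x :: w) = x (+) b1 :: s w by case: x; rewrite ?e1 ?e2 ?b12.
by rewrite sE nuE heps; case: b (b1) (b3) => -[] [].
Qed.

(** The automorphisms chosen for the various levels agree on [tree_field] of the lower level, hence
    glue to an automorphism of the union. *)
Lemma lift_arboreal_image s :
  (forall n, crit_nz g c n) -> tree_aut tree_infty s ->
  (forall n, exists nu : {rmorphism algC -> algC},
    forall w, (size w <= n)%N -> l (s w) = nu (l w)) ->
  arboreal_image (splitting_infty f) tree_infty l s.
Proof.
move=> cn sT /choice[nu hnu]; split=> //.
have nuK m n z : (m <= n)%N -> tree_field l m z -> nu m z = nu n z.
  move=> mn; apply: gen_equal => x /= /mapP[w].
  rewrite mem_words => /eqP sw ->; rewrite -!hnu ?sw //.
have nuK2 m n z : tree_field l m z -> tree_field l n z -> nu m z = nu n z.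
  by move=> hm hn; have [/nuK->|/ltnW/nuK->] := leqP m n.
pose K := splitting_infty f.
have KP z : K z <-> exists n, tree_field l n z.
  split=> [[n _]|[n hn]]; first by rewrite splittingE; exists n.
  by exists n => //; rewrite splittingE.
(* The value 0 is assigned outside the union, where an element of [galois_group] is
   unconstrained. *)
have /choice[sig hsig] : forall z, exists y, forall n, tree_field l n z -> y = nu n z.
  move=> z; have [[m hm]|h] := pselect (exists m, tree_field l m z).
    by exists (nu m z) => n hn; apply: nuK2.
  by exists 0 => n hn; case: h; exists n.
have join x y : K x -> K y -> exists n, tree_field l n x /\ tree_field l n y.
  move=> /KP[m hm] /KP[n hn]; exists (m + n)%N.
  by split; [apply: (tree_fieldS lT _ hm); rewrite ?leq_addr|apply: (tree_fieldS lT _ hn); rewrite ?leq_addl].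
exists sig; last first.
  move=> w _; rewrite (hsig _ (size w)) -?hnu //.
  exact: (tree_field_label lT).
split.
- split.
  + move=> z /KP[n hn]; apply/KP; exists n; rewrite (hsig _ _ hn).
    exact: (aut_tree_field lT).
  + move=> x y; rewrite !inE => Kx Ky; have [n [hx hy]] := join _ _ Kx Ky.
    by rewrite !(hsig _ n) // => /fmorph_inj.
  + move=> z /KP[n hn]; exists (algC_invaut (nu n) z).
      by apply/KP; exists n; apply: (aut_tree_field lT).
    by rewrite (hsig _ n) ?algC_invautK //; apply: (aut_tree_field lT).
- move=> x y; rewrite !inE => Kx Ky; have [n [hx hy]] := join _ _ Kx Ky.
  rewrite !(hsig _ n) ?rmorphD //.
  exact: (subfldD (tree_field_subfld _ _) hx hy).
- move=> x y; rewrite !inE => Kx Ky; have [n [hx hy]] := join _ _ Kx Ky.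
  rewrite !(hsig _ n) ?rmorphM //.
  exact: (subfldM (tree_field_subfld _ _) hx hy).
- move=> q; rewrite (hsig _ 0%N) ?fmorph_rat //.
  exact: (subfld_rat (tree_field_subfld _ _)).
Qed.

End Arboreal.

(** * Composition of tree automorphisms and the index *)

Lemma galois_group_comp (K : set algC) s t :
  galois_group K s -> galois_group K t -> galois_group K (s \o t).
Proof.
move=> [sK sD sM sQ] [tK tD tM tQ].
have tKK x : x \in K -> t x \in K by rewrite !inE; case: tK => h _ _; apply: h.
split; first exact: set_bij_comp tK sK.
- by move=> x y Kx Ky /=; rewrite tD // sD // tKK.
- by move=> x y Kx Ky /=; rewrite tM // sM // tKK.
- by move=> q /=; rewrite tQ sQ.
Qed.

Lemma tree_aut_comp (V : set (seq bool)) s t :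
  tree_aut V s -> tree_aut V t -> tree_aut V (s \o t).
Proof.
move=> [sV sb] [tV tb]; split; first exact: set_bij_comp tV sV.
move=> w Vw /=; rewrite tb // sb //; case: tV => h _ _; exact: h.
Qed.

Lemma arboreal_image_comp (K : set algC) (V : set (seq bool)) l s t :
  arboreal_image K V l s -> arboreal_image K V l t ->
  arboreal_image K V l (s \o t).
Proof.
move=> [sT [sig sG hs]] [tT [tau tG ht]]; split; first exact: tree_aut_comp.
exists (sig \o tau); first exact: galois_group_comp.
by move=> w Vw /=; rewrite hs ?ht //; case: tT => [[h _ _] _]; apply: h.
Qed.

Lemma tree_aut_divl s s' : tree_aut tree_infty s -> tree_aut tree_infty s' ->
  exists2 u, tree_aut tree_infty u & forall w, s' (u w) = s w.
Proof.
move=> [[_ sinj ssurj] sb] [[_ s'inj s'surj] s'b].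
have inj' x y : s' x = s' y -> x = y by move=> e; apply: s'inj; rewrite ?inE.
have /choice[u hu] : forall w, exists w', s' w' = s w.
  by move=> w; have [w' _ e] := s'surj (s w) I; exists w'.
exists u => //; split; first split=> //.
- by move=> x y _ _ /(congr1 s'); rewrite !hu => e; apply: sinj; rewrite ?inE.
- move=> w _; have [v _ e] := ssurj (s' w) I; exists v => //.
  by apply: inj'; rewrite hu.
- by move=> w _; apply: inj'; rewrite hu s'b // hu sb.
Qed.

Lemma iter_behead_cat k (w : seq bool) : iter k behead w = drop k w.
Proof. by elim: k => [|k IHk]; rewrite ?drop0 //= IHk -drop1 drop_drop. Qed.

Lemma level_agree n (s s' : seq bool -> seq bool) :
  tree_aut tree_infty s -> tree_aut tree_infty s' ->
  (forall w, size w = n -> s w = s' w) ->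
  forall w, (size w <= n)%N -> s w = s' w.
Proof.
move=> [_ sb] [_ sb'] h w sw.
have Dw : w = iter (n - size w) behead (nseq (n - size w) false ++ w).
  by rewrite iter_behead_cat drop_size_cat ?size_nseq.
have it k v : s (iter k behead v) = iter k behead (s v) /\
    s' (iter k behead v) = iter k behead (s' v).
  by elim: k => //= k [e e']; rewrite sb ?sb' // e e'.
rewrite Dw; have [-> ->] := it (n - size w)%N (nseq (n - size w) false ++ w).
by rewrite h // size_cat size_nseq subnK.
Qed.

(** [H] contains all automorphisms trivial up to level [n], so a coset is determined by the action
    on level [n], and there are at most as many cosets as self-maps of that level. *)
Lemma index_le_level n (H : set (seq bool -> seq bool)) :
  H `<=` tree_aut tree_infty ->
  (forall s t, H s -> H t -> H (s \o t)) ->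
  (forall s, tree_aut tree_infty s ->
    (forall w, (size w <= n)%N -> s w = w) -> H s) ->
  index_le H #|{ffun n.-tuple bool -> n.-tuple bool}|.
Proof.
move=> HT Hcomp Htriv; rewrite /index_le.
pose T := ({ffun n.-tuple bool -> n.-tuple bool} : finType); rewrite -/T.
(* The default of [insubd] does not occur for tree automorphisms, which preserve the length of
   words. *)
pose rho (s : seq bool -> seq bool) : T := [ffun t : n.-tuple bool => insubd t (s t)].
pose coset (s : seq bool -> seq bool) : set (seq bool -> seq bool) := [set s \o t | t in H].
have rhoP s s' : tree_aut tree_infty s -> tree_aut tree_infty s' ->
    rho s = rho s' -> forall w, (size w <= n)%N -> s w = s' w.
  move=> sT s'T e; apply: level_agree => // w /eqP sw.
  have := congr1 (fun r : T => val (r (Tuple sw))) e; rewrite !ffunE !val_insubd /=.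
  by rewrite !tree_aut_size // sw.
have sub s s' : tree_aut tree_infty s -> tree_aut tree_infty s' ->
    rho s = rho s' -> coset s `<=` coset s'.
  move=> sT s'T e _ [t Ht <-]; have [u uT hu] := tree_aut_divl sT s'T.
  exists (u \o t); last by apply/funext => w /=; rewrite hu.
  apply: Hcomp => //; apply: Htriv => // w wn.
  case: s'T (rhoP _ _ sT s'T e w wn) => [[_ inj _] _]; rewrite -hu => e'.
  by apply: inj; rewrite ?inE.
(* A representative is chosen in each coset, so that cosets inject into the finite type through
   [rho]. *)
have /choice[r hr] : forall A : set (seq bool -> seq bool), exists s,
    [set coset s | s in tree_aut tree_infty] A ->
    tree_aut tree_infty s /\ coset s = A.
  move=> A; have [[s sT <-]|h] := pselect ([set coset s | s in tree_aut tree_infty] A).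
    by exists s.
  by exists id => /h.
set C := [set _ | _ in _].
pose code A : nat := enum_rank (rho (r A)).
have codeI : {in C &, injective code}.
  move=> A B; rewrite !inE => /hr[rA eA] /hr[rB eB] /ord_inj/enum_rank_inj e.
  by rewrite -eA -eB; apply/seteqP; split; apply: sub.
rewrite -(card_le_eql (inj_card_eq codeI)); apply: subset_card_le => _ [A _ <-].
exact: ltn_ord.
Qed.

(** * Climbing the tree *)

(** A labelling is kept up to level [n] and continued beyond it by the explicit roots [g + sqrt] and
    [g - sqrt]. *)
Fixpoint extend_label (g c : int) (n : nat) (l : seq bool -> algC) (w : seq bool) : algC :=
  if w is b :: u then
    if (size u < n)%N then l w
    else g%:~R + (-1) ^+ b * sqrtC (extend_label g c n l u - c%:~R)
  else l [::].

Lemma extend_label_low g c n l w :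
  (size w <= n)%N -> extend_label g c n l w = l w.
Proof. by case: w => //= b u ->. Qed.

Lemma extend_label_tree g c n l :
  labelling (qpoly g c) (tree n) l -> preimage_tree g c (extend_label g c n l).
Proof.
move=> hl; have l0 : l [::] = 0.
  have [[h _ _] _] := hl [::] (leq0n n).
  have := h [::] erefl; rewrite /preimages /= /root /iterate /=.
  by rewrite map_polyX hornerX => /eqP.
have ext_sqrt w b : (size w < n)%N = false -> extend_label g c n l (b :: w) =
    g%:~R + (-1) ^+ b * sqrtC (extend_label g c n l w - c%:~R).
  by move=> /= ->.
have hp b w : quadmap g%:~R c%:~R (extend_label g c n l (b :: w)) = extend_label g c n l w.
  have [wn|/negbTE wn] := boolP (size w < n)%N; last first.
    rewrite ext_sqrt // /quadmap addrAC subrr add0r exprMn sqrtCK sqrr_sign.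
    by rewrite mul1r subrK.
  rewrite !extend_label_low //; last exact: ltnW.
  by have [_] := hl (b :: w) wn; rewrite horner_qpoly; apply.
split=> // w; have [wn|/negbTE wn] := boolP (size w < n)%N; last first.
  by rewrite !ext_sqrt //= expr0 expr1; ring.
(* Up to level [n] siblings have distinct labels with the same image, so these are symmetric about
   [g]. *)
have e : quadmap g%:~R c%:~R (extend_label g c n l (true :: w)) =
    quadmap g%:~R c%:~R (extend_label g c n l (false :: w)) by rewrite !hp.
move: e; rewrite !extend_label_low // => /addIr/eqP; rewrite eqf_sqr.
case/orP => /eqP e; last by rewrite -(subrK g%:~R (l (true :: w))) e; ring.
have [[_ linj _] _] := hl (true :: w) wn.
have : true :: w = false :: w; last by [].
by apply: linj; rewrite ?inE //; apply: (addIr (- g%:~R)).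
Qed.

(** Automorphisms flipping whole levels at once; they already act transitively on every level. *)
Fixpoint xor_word (d : nat -> bool) (w : seq bool) : seq bool :=
  if w is b :: u then (b (+) d (size u)) :: xor_word d u else [::].

Lemma size_xor_word d w : size (xor_word d w) = size w.
Proof. by elim: w => //= b w ->. Qed.

Lemma xor_wordK d : involutive (xor_word d).
Proof. by elim=> //= b w IHw; rewrite size_xor_word IHw addbK. Qed.

Lemma xor_word_trans w w' : size w = size w' -> exists d, xor_word d w = w'.
Proof.
elim: w w' => [|b w IHw] [|b' w'] //= => [_|[sw]]; first by exists (fun=> false).
have [d hd] := IHw w' sw.
exists (fun i => if i == size w then b (+) b' else d i).
rewrite eqxx addbA addbb addFb; congr (_ :: _); rewrite -hd.
have low v : (size v <= size w)%N ->
    xor_word (fun i => if i == size w then b (+) b' else d i) v = xor_word d v.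
  by elim: v => //= a v IHv sv; rewrite (ltn_eqF sv) IHv //; apply: ltnW.
exact: low.
Qed.

Lemma xor_word_aut d n : tree_aut (tree n) (xor_word d).
Proof.
split; last by move=> [|b w].
split=> [w|u v _ _|w] /=; rewrite /tree /=.
- by rewrite size_xor_word.
- by move/(congr1 (xor_word d)); rewrite !xor_wordK.
- by exists (xor_word d w); rewrite ?size_xor_word ?xor_wordK.
Qed.

Lemma tree_aut_restrict s n : tree_aut tree_infty s -> tree_aut (tree n) s.
Proof.
move=> sT; have sz := tree_aut_size sT; have [[_ sinj ssurj] sb] := sT.
split; last by move=> w _; apply: sb.
split=> [w|u v _ _|w wn] /=; rewrite /tree /=; first by rewrite sz.
  by apply: sinj; rewrite inE.
by have [v _ e] := ssurj w I; exists v => //; rewrite /= -sz e.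
Qed.

Lemma crit_nzS g c n : crit_nz g c n -> crit g c n.+1 != 0 -> crit_nz g c n.+1.
Proof.
move=> cn c1 j /andP[j0]; rewrite leq_eqVlt => /orP[/eqP -> //|jn].
by apply: cn; rewrite j0.
Qed.

(** Nonvanishing and transitivity up to level [n] appear as premises because the climb supplies them
    one level at a time. *)
Definition nonsquare_from (g c : int) (n0 : nat) : Prop :=
  forall (l : seq bool -> algC) n, preimage_tree g c l -> (n0 <= n)%N ->
    crit_nz g c n -> (forall m, (m <= n)%N -> tree_transitive l m) ->
    forall y, tree_field l n y -> y ^+ 2 != (crit g c n.+1)%:~R.

Section Tower.
Variables (g c : int) (n0 : nat).
Hypothesis n0_gt0 : (0 < n0)%N.
Hypothesis hns : nonsquare_from g c n0.
Let f : {poly rat} := qpoly g c.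

(** A nonsquare critical value is in particular nonzero, as 0 is a square, and it gives transitivity
    one level higher; so the induction feeds itself. *)
Lemma tower_flippable l : preimage_tree g c l -> crit_nz g c n0 ->
  (forall m, (m <= n0)%N -> tree_transitive l m) ->
  (forall n, crit_nz g c n) /\ (forall n, (n0 <= n)%N -> flippable l n).
Proof.
move=> lT c0 t0.
have H k : crit_nz g c (n0 + k) /\
    forall m, (m <= n0 + k)%N -> tree_transitive l m.
  elim: k => [|k [ck tk]]; first by rewrite addn0.
  have ns := hns lT (leq_addr k n0) ck tk.
  have nk0 : (0 < n0 + k)%N by rewrite addn_gt0 n0_gt0.
  rewrite addnS; split.
    apply: crit_nzS => //; have := ns 0 (subfld0 (tree_field_subfld _ _)).
    by rewrite expr0n /= eq_sym intr_eq0.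
  move=> m; rewrite leq_eqVlt => /orP[/eqP ->|mk]; last exact: tk.
  exact: tree_transitiveS (tk _ (leqnn _)) ns.
split=> [n j /andP[j0 jn]|n n0n eps].
  have [h _] := H n; apply: h; rewrite j0 /=.
  by apply: leq_trans jn _; apply: leq_addl.
have [ck tk] := H (n - n0)%N; rewrite subnKC // in ck tk.
by apply: (sibling_flips lT) => //; [exact: leq_trans n0_gt0 n0n|exact: tk|exact: hns].
Qed.

(** Fullness at level [n0] yields transitivity, by realizing the maps [xor_word], and nonzero
    critical values, by injectivity of the labelling. Every tree automorphism then lifts from level
    [n0]. *)
Lemma full_of_level : galois_full f n0 -> galois_full_infty f.
Proof.
move=> [_ [l0 hl0 full0]].
have lT := extend_label_tree hl0; set l := extend_label g c n0 l0 in lT.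
have El w : (size w <= n0)%N -> l w = l0 w by apply: extend_label_low.
have realize s : tree_aut (tree n0) s -> exists nu : {rmorphism algC -> algC},
    forall w, (size w <= n0)%N -> l (s w) = nu (l w).
  rewrite -full0 => -[sT [sig]]; rewrite (splittingE lT) => /galois_group_extend[nu hnu] h.
  exists nu => w wn; rewrite hnu; last exact: (tree_field_label lT).
  rewrite !El //; first exact: h.
  by case: sT => [[H _ _] _]; apply: (H w).
have tr m : (m <= n0)%N -> tree_transitive l m.
  move=> mn w w' sw sw'; have [d hd] : exists d, xor_word d w = w'.
    by apply: xor_word_trans; rewrite sw.
  have [nu hnu] := realize _ (xor_word_aut d n0).
  by exists nu; rewrite -hnu ?hd // sw.
have c0 : crit_nz g c n0.
  move=> j /andP[j0 jn]; apply: (crit_nz_label lT j0) => w w' sw sw'.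
  have [[_ linj _] _] := hl0 w (leq_trans (eq_leq sw) jn : tree n0 w).
  rewrite !El ?sw ?sw' // => e; apply: linj => //.
    by rewrite inE.
  by rewrite inE /= sw sw'.
have [cn fl] := tower_flippable lT c0 tr.
split; first by move=> m; apply: (crit_nz_separable lT).
exists l.
  move=> w _; apply: (tree_labelling lT (cn (size w)) (V := [set u | (size u <= size w)%N])) => //=.
apply/seteqP; split=> [s []//|s sT].
have [nu0 hnu0] := realize s (tree_aut_restrict n0 sT).
apply: lift_arboreal_image => //.
exact: (flippable_lift lT cn fl sT hnu0).
Qed.

(** Irreducible iterates give transitivity on all levels. Automorphisms trivial up to level [n0]
    lift from the identity, so they all belong to the image. *)
Lemma index_of_stable : stable f ->
  galois_index_le f #|{ffun n0.-tuple bool -> n0.-tuple bool}|.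
Proof.
move=> st.
(* The labelling starts from the root alone; all further labels come from square roots. *)
have hl0 : labelling f (tree 0) (fun=> 0).
  move=> [|//] _; split=> //; split=> [u /= _|u v|z].
  2: by rewrite !inE /= => /size0nil -> /size0nil ->.
  - by rewrite /preimages /= /root /iterate /= map_polyX hornerX.
  - by rewrite /preimages /= /root /iterate /= map_polyX hornerX => /eqP ->; exists [::].
have lT := extend_label_tree hl0; set l := extend_label _ _ _ _ in lT.
have tr m : tree_transitive l m.
  case: m => [[|//] [|//] _ _|m w w' sw sw']; first by exists idfun.
  have rt u : size u = m.+1 -> root (map_poly ratr (iterate f m.+1)) (l u).
    move=> su; have : u \in words m.+1 by rewrite mem_words su.
    move=> /(map_f l) h; suff : preimages f m.+1 (l u) by [].
    by rewrite (preimagesE lT).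
  exact: irreducible_galois_transitive (st m.+1 isT) (rt w sw) (rt w' sw').
have cn n : crit_nz g c n.
  move=> j /andP[j0 _]; apply/negP => /eqP cj.
  have [_ irr] := st j j0.
  have rC : root (map_poly ratr (iterate f j) : {poly algC}) (ratr g%:~R).
    rewrite /root horner_iterate_qpoly ratr_int.
    by move: (rmorph_iter_quadmap (intr : {rmorphism int -> algC}) g c j g); rewrite -/(crit g c j) cj rmorph0 => <-.
  (* A zero critical value makes [g] a rational root of an irreducible polynomial of degree [2 ^ j],
     which is at least 2. *)
  have : ('X - (g%:~R)%:P) %= iterate f j.
    by apply: irr; rewrite ?size_XsubC // dvdp_XsubCl -(fmorph_root (ratr : {rmorphism rat -> algC})).
  move/eqp_size; rewrite size_XsubC -(size_map_poly (ratr : {rmorphism rat -> algC})).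
  rewrite (map_iterate_prod lT) size_prod_XsubC size_words => -[].
  by case: j j0 {cj irr rC} => // j _; rewrite expnS; have := expn_gt0 2 j; lia.
have [_ fl] := tower_flippable lT (cn n0) (fun m _ => tr m).
split; first by move=> m; apply: (crit_nz_separable lT).
exists l.
  by move=> w _; apply: (tree_labelling lT (cn (size w)) (V := [set u | (size u <= size w)%N])) => //=.
apply: index_le_level.
- by move=> s [].
- by move=> s t; apply: arboreal_image_comp.
- move=> s sT s1; apply: lift_arboreal_image => //.
  apply: (@flippable_lift _ _ _ lT n0 s idfun cn fl sT) => w wn /=.
  by rewrite s1.
Qed.

End Tower.

(** * Growth of the critical orbit *)

(** [d] is the product of the primes with odd exponent; these are distinct, so divisibility can be
    tested one prime at a time. *)
Lemma squarefree_part (m D : nat) : (0 < m)%N ->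
  (forall p, prime p -> odd (logn p m) -> (p %| D)%N) ->
  exists d y, [/\ m = (d * y ^ 2)%N & (d %| D)%N].
Proof.
move=> m0 hD.
exists (\prod_(p <- primes m) p ^ odd (logn p m))%N, (\prod_(p <- primes m) p ^ (logn p m)./2)%N.
split.
  rewrite -mulnn -!big_split /= {1}(prod_prime_decomp m0) prime_decompE big_map /=.
  by apply: eq_bigr => p _; rewrite -!expnD addnn -{1}(odd_double_half (logn p m)).
have : all prime (primes m) by apply/allP => p; rewrite mem_primes => /andP[].
have := primes_uniq m; elim: (primes m) => [|p ps IHps]; first by rewrite big_nil dvd1n.
rewrite /= big_cons => /andP[pps ups] /andP[pp aps].
rewrite Gauss_dvd ?IHps ?andbT //.
  by case E : (odd _); rewrite ?dvd1n // expn1 hD.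
rewrite coprimeXl // coprime_sym.
elim: ps pps ups aps {IHps} => [|q qs IHqs]; first by rewrite big_nil coprime1n.
rewrite /= inE negb_or big_cons => /andP[pq pqs] /andP[_ uqs] /andP[pq' aqs].
rewrite coprimeMl IHqs // andbT coprimeXl // prime_coprime // dvdn_prime2 //.
by rewrite eq_sym.
Qed.

Definition qmaj (g c m : nat) : nat := ((m + g) ^ 2 + c)%N.

Section Growth.
Variables (g c : int) (X E : nat).
Hypotheses (X3 : (3 <= X)%N).
Hypotheses (gX : (`|g| <= X ^ E)%N) (cX : (`|c| <= X ^ E)%N).

(** The [- 2] in the exponent is the slack of the induction: [4 P^2 + P] is at most [X^2 P^2]
    because [X] is at least 3. *)
Lemma qmaj_iter n m : (m <= X ^ E)%N ->
  (iter n (qmaj `|g| `|c|) m <= X ^ (2 ^ n * (E + 2) - 2))%N.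
Proof.
move=> mE; elim: n => [|n IHn] /=; first by rewrite mul1n addnK.
set e := (2 ^ n * (E + 2) - 2)%N in IHn *.
have n2 : (0 < 2 ^ n)%N by rewrite expn_gt0.
have Ee : (E <= e)%N by rewrite /e; nia.
have -> : (2 ^ n.+1 * (E + 2) - 2 = (e + e) + 2)%N by rewrite expnS /e; nia.
have gXe : (`|g| <= X ^ e)%N by apply: leq_trans gX _; rewrite leq_pexp2l //; lia.
have cXe : (`|c| <= X ^ e)%N by apply: leq_trans cX _; rewrite leq_pexp2l //; lia.
rewrite !expnD /qmaj.
move: gXe cXe IHn; set A := iter _ _ _; set P := (X ^ e)%N => gXe cXe IHn.
have : ((A + `|g|) ^ 2 <= (2 * P) ^ 2)%N by rewrite leq_exp2r //; lia.
have : (1 <= P)%N by rewrite /P expn_gt0; lia.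
have : (9 <= X ^ 2)%N by rewrite -[9%N]/(3 ^ 2)%N leq_exp2r.
rewrite expnMn; move: (X ^ 2)%N ((A + _) ^ 2)%N => X2 B; nia.
Qed.

Lemma absz_quadmap z : (`|quadmap g c z| <= qmaj `|g| `|c| `|z|)%N.
Proof.
rewrite /quadmap /qmaj.
have h1 : (`|z - g| <= `|z| + `|g|)%N by lia.
have h2 : (`|(z - g) ^+ 2| <= (`|z| + `|g|) ^ 2)%N by rewrite abszX leq_exp2r.
move: h2; set a := (z - g) ^+ 2; set b := (_ ^ 2)%N; lia.
Qed.

Lemma qmaj_mono m m' : (m <= m')%N -> (qmaj `|g| `|c| m <= qmaj `|g| `|c| m')%N.
Proof. by move=> mm'; rewrite /qmaj leq_add2r leq_exp2r // leq_add2r. Qed.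

Lemma absz_iter_quadmap n z : (`|z| <= X ^ E)%N ->
  (`|iter n (quadmap g c) z| <= X ^ (2 ^ n * (E + 2)))%N.
Proof.
move=> zE; apply: (@leq_trans (iter n (qmaj `|g| `|c|) `|z|)%N).
  by elim: n => //= n IHn; apply: leq_trans (absz_quadmap _) (qmaj_mono IHn).
by apply: leq_trans (qmaj_iter n zE) _; rewrite leq_pexp2l ?leq_subr //; lia.
Qed.

Hypothesis DX : X = `|c - g|%N.

(** The factor 2 carries the induction, as [4 P^2 - X] is at least [2 P^2], and later absorbs the
    translation by [g]. It is first available at the second iterate, [(c - g) * (c - g + 1)]. *)
Lemma absz_iter_lower n :
  (2 * X ^ (2 ^ n) <= `|iter n.+2 (quadmap 0 (c - g)) 0|)%N.
Proof.
elim: n => [|n IHn].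
  rewrite /= /quadmap !subr0 expr0n add0r expn0 expn1.
  have -> : (c - g) ^+ 2 + (c - g) = (c - g) * (c - g + 1) by ring.
  by rewrite abszM -DX mulnC leq_mul2l; apply/orP; right; lia.
set v := iter n.+2 _ _ in IHn *; rewrite iterS -/v /quadmap subr0.
have : (`|v| ^ 2 - X <= `|(v ^+ 2 + (c - g))%R|)%N.
  by rewrite -abszX; move: (v ^+ 2) => w; lia.
apply: leq_trans; rewrite expnS [(2 * 2 ^ n)%N]mulnC expnM.
have X1 : (X <= X ^ (2 ^ n))%N by rewrite -{1}(expn1 X) leq_pexp2l ?expn_gt0 //; lia.
move: IHn X1; set P := (X ^ (2 ^ n))%N => IHn X1.
have : ((2 * P) ^ 2 <= `|v| ^ 2)%N by rewrite leq_exp2r.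
rewrite expnMn; move: (`|v| ^ 2)%N => V; rewrite -mulnn; nia.
Qed.

Lemma crit_conj n : crit g c n = iter n (quadmap 0 (c - g)) 0 + g.
Proof.
rewrite /crit; elim: n => [|n IHn] /=; first by rewrite add0r.
by rewrite IHn /quadmap; ring.
Qed.

Lemma absz_crit_lower n : (E <= 2 ^ n)%N ->
  (X ^ (2 ^ n) <= `|crit g c n.+2|)%N.
Proof.
move=> En; have := absz_iter_lower n; rewrite crit_conj.
have : (X ^ E <= X ^ (2 ^ n))%N by rewrite leq_pexp2l //; lia.
by move: gX (iter _ _ _); move: (X ^ E)%N (X ^ 2 ^ n)%N => P1 P2 h u; clear -h; lia.
Qed.

End Growth.

(** * Common prime divisors in the critical orbit *)

Lemma dvdz_iter_quadmap (g c x y : int) n :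
  (x - y %| iter n (quadmap g c) x - iter n (quadmap g c) y)%Z.
Proof.
elim: n => //= n; move: (iter n _ x) (iter n _ y) => a b ab.
have -> : quadmap g c a - quadmap g c b = (a - b) * (a + b - 2 * g).
  by rewrite /quadmap; ring.
exact: dvdz_mulr.
Qed.

(** Modulo [p] the orbit restarts from 0 at index [j]. *)
Lemma dvd_crit_diff (g c : int) p j k : (p %| `|crit g c j|)%N ->
  (p %| `|crit g c (k + j)|)%N -> (p %| `|iter k (quadmap g c) 0|)%N.
Proof.
move=> pj pk.
have : (p %| crit g c (k + j) - iter k (quadmap g c) 0)%Z.
  rewrite /crit iterD -/(crit g c j); apply: dvdz_trans (dvdz_iter_quadmap _ _ _ _ _).
  by rewrite subr0.
move=> h; suff : (p %| iter k (quadmap g c) 0)%Z by rewrite dvdzE.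
by rewrite -[iter k _ _](subKr (crit g c (k + j))) rpredB // dvdzE.
Qed.

(** A prime dividing [b_N] and some earlier [b_j] divides [b_j] or the iterate of 0 of index
    [N - j], and one of these indices is at most [N / 2]. The factor 2 accounts for the even
    prime. *)
Definition primitive_bound (g c : int) (N : nat) : nat :=
  (2 * \prod_(1 <= j < N./2.+1) (`|crit g c j| * `|iter j (quadmap g c) 0|))%N.

Lemma primitive_bound_dvd (g c : int) N p : prime p ->
  (exists2 j, (0 < j < N)%N & (p %| `|crit g c j|)%N) ->
  (p %| `|crit g c N|)%N -> (p %| primitive_bound g c N)%N.
Proof.
move=> pp [j /andP[j0 jN] pj] pN; apply: dvdn_mull.
have dv i : (0 < i)%N -> (i <= N./2)%N -> (p %| `|crit g c i| * `|iter i (quadmap g c) 0|)%N ->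
    (p %| \prod_(1 <= j < N./2.+1) (`|crit g c j| * `|iter j (quadmap g c) 0|))%N.
  move=> i0 iN h; rewrite (bigD1_seq i) ?iota_uniq ?mem_index_iota ?i0 //=.
  exact: dvdn_mulr.
have [jh|jh] := leqP j N./2; first by apply: (dv j) => //; apply: dvdn_mulr.
apply: (dv (N - j)%N); [lia|lia|apply: dvdn_mull].
by apply: (dvd_crit_diff pj); rewrite subnK // ltnW.
Qed.

(** The exponents [2 * 2^j * (E + 2)] sum geometrically, and the factor 2 costs one more [X]. *)
Lemma primitive_bound_le (g c : int) X E N : (3 <= X)%N ->
  (`|g| <= X ^ E)%N -> (`|c| <= X ^ E)%N ->
  (primitive_bound g c N <= X ^ (1 + 4 * 2 ^ N./2 * (E + 2)))%N.
Proof.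
move=> X3 gX cX; rewrite /primitive_bound expnD expn1; apply: leq_mul; first lia.
elim: N./2 => [|h IHh]; first by rewrite big_geq // expn_gt0; lia.
rewrite big_nat_recr //.
have -> : (4 * 2 ^ h.+1 * (E + 2) = 4 * 2 ^ h * (E + 2) + (2 ^ h.+1 * (E + 2) + 2 ^ h.+1 * (E + 2)))%N.
  by rewrite expnS; ring.
rewrite !expnD; apply: leq_mul => //; apply: leq_mul.
  by rewrite /crit; apply: absz_iter_quadmap.
by apply: absz_iter_quadmap; rewrite // absz0.
Qed.

(** * Critical values are not squares *)

(** The height bound in degree [2 ^ k], exponentiated and with natural constants. *)
Definition int_point_bound (k Ch C0 : nat) : Prop :=
  forall F : {poly int}, size F = (2 ^ k).+1 ->
    disc (map_poly intr F : {poly rat}) != 0 ->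
  forall H : nat, (0 < H)%N -> (forall i, (`|(F`_i)%R| <= H)%N) ->
  forall x y : int, y ^+ 2 = F.[x] -> (`|x| <= 2 ^ C0 * H ^ Ch)%N.

Lemma heightz (R : realType) (x : int) :
  height R x%:~R = ln (maxn `|x|%N 1)%:R.
Proof.
rewrite /height numq_int denq_int.
by have -> : Num.max `|x| `|1| = (maxn `|x|%N 1)%:Z by lia.
Qed.

Lemma height_bound_int (R : realType) k :
  height_bound R (2 ^ k) -> exists Ch C0, int_point_bound k Ch C0.
Proof.
move=> [C1 [C2 hC]].
have ln2 : 0 < ln 2 :> R by rewrite ln_gt0 // ltr1n.
exists (Num.bound `|C1|), (Num.bound (`|C2| / ln 2)) => F sF dF H H0 hF x y e.
have := hC F sF dF x y e; rewrite heightz => h.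
set C0 := Num.bound (_ / _); set Ch := Num.bound _.
have H0R : 0 < H%:R :> R by rewrite ltr0n.
have lnH : 0 <= ln H%:R :> R by rewrite ln_ge0 // ler1n.
have hp : height_poly R F <= ln H%:R.
  apply/bigmax_leP; split=> // i _; rewrite heightz ler_ln ?posrE ?ltr0n //; last by lia.
  by rewrite ler_nat geq_max hF H0.
have hp0 : 0 <= height_poly R F by apply: bigmax_ge_id.
have hC1 : C1 * height_poly R F <= Ch%:R * ln H%:R.
  apply: (@le_trans _ _ (`|C1| * height_poly R F)).
    by rewrite ler_wpM2r // ler_norm.
  by apply: ler_pM => //; apply/ltW/archi_boundP.
have hC2 : C2 <= C0%:R * ln 2.
  apply: le_trans (ler_norm _) _; rewrite -ler_pdivrMr //.
  by apply/ltW/archi_boundP; rewrite divr_ge0 // ltW.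
have {h} : ln (maxn `|x|%N 1)%:R <= ln (2 ^ C0 * H ^ Ch)%:R :> R.
  apply: le_trans h _; rewrite natrM !natrX lnM ?posrE ?exprn_gt0 //.
  by rewrite !lnXn // -[ln 2 *+ _]mulr_natl -[ln H%:R *+ _]mulr_natl addrC lerD.
rewrite ler_ln ?posrE ?ltr0n ?muln_gt0 ?expn_gt0 ?H0 //; last by lia.
by rewrite ler_nat; lia.
Qed.

(** * Coefficients and discriminants of the iterates *)

Lemma map_iterate (R S : nzRingType) (h : {rmorphism R -> S}) (p : {poly R}) n :
  map_poly h (iterate p n) = iterate (map_poly h p) n.
Proof.
rewrite /iterate; elim: n => [|n IHn] /=; first by rewrite map_polyX.
by rewrite map_comp_poly IHn.
Qed.

Lemma horner_iterate_quad (g c x : int) n :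
  (iterate (quad g c) n).[x] = iter n (quadmap g c) x.
Proof.
rewrite /iterate; elim: n => [|n IHn] /=; first by rewrite hornerX.
by rewrite horner_comp IHn /quad !hornerE.
Qed.

(** The coefficients are dominated by those of a polynomial with nonnegative coefficients, whose
    value at 1 follows the recursion of [qmaj]. *)
Lemma coef_iterate_quad (g c : int) n i :
  (`|((iterate (quad g c) n)`_i)%R| <= iter n (qmaj `|g| `|c|) 1)%N.
Proof.
suff [P hP P1] : exists2 P : {poly int},
    (forall i, `|(iterate (quad g c) n)`_i| <= P`_i) &
    P.[1] = (iter n (qmaj `|g| `|c|) 1%N)%:Z.
  have Pge0 j : 0 <= P`_j by apply: le_trans (hP j).
  rewrite -lez_nat abszE -P1; apply: le_trans (hP i) _.
  have [iP|iP] := ltnP i (size P); last first.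
    by rewrite nth_default // horner_coef sumr_ge0 // => j _; rewrite expr1n mulr1.
  rewrite horner_coef (bigD1 (Ordinal iP)) //= expr1n mulr1 lerDl.
  by rewrite sumr_ge0 // => j _; rewrite expr1n mulr1.
rewrite /iterate; elim: n => [|n [P hP P1]] /=.
  by exists 'X; rewrite ?hornerX // => j; rewrite coefX; case: (_ == _).
set p := iter n _ _ in hP *.
have -> : quad g c \Po p = (p - g%:P) ^+ 2 + c%:P.
  by rewrite /quad comp_polyD rmorphXn /= comp_polyB comp_polyX !comp_polyC.
exists ((P + `|g|%:P) ^+ 2 + `|c|%:P); last first.
  by rewrite hornerD horner_exp hornerD !hornerC P1 /qmaj; lia.
have hD j : `|(p - g%:P)`_j| <= (P + `|g|%:P)`_j.
  rewrite coefB coefD !coefC; apply: le_trans (ler_normB _ _) _; apply: lerD => //.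
  by case: (j == 0)%N; rewrite ?normr0.
move=> j; rewrite !coefD !coefC; apply: le_trans (ler_normD _ _) _; apply: lerD.
  rewrite !expr2 !coefM; apply: le_trans (ler_norm_sum _ _ _) _; apply: ler_sum => m _.
  by rewrite normrM; apply: ler_pM.
by case: (j == 0)%N; rewrite ?normr0.
Qed.

Lemma disc_scale_neq0 (F : fieldType) (a : F) (p : {poly F}) :
  a != 0 -> p != 0 -> separable_poly p -> disc (a *: p) != 0.
Proof.
move=> a0 p0; rewrite separable_poly.unlock => sp; rewrite /disc.
rewrite !mulf_neq0 ?invr_eq0 ?lead_coef_eq0 ?scaler_eq0 ?negb_or ?a0 //.
  by rewrite expf_eq0 oppr_eq0 oner_eq0 andbF.
rewrite resultant_eq0 derivZ -leqNgt.
have : coprimep (a *: p) (a *: p^`()) by rewrite coprimepZl ?coprimepZr.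
by rewrite /coprimep => /eqP ->.
Qed.

Lemma nonsquare_of_bound (g c : int) (X E k Ch C0 : nat) : (3 <= X)%N ->
  X = `|c - g|%N -> (`|g| <= X ^ E)%N -> (`|c| <= X ^ E)%N ->
  int_point_bound k Ch C0 ->
  nonsquare_from g c
    (2 * (C0 + Ch * (1 + 2 ^ k * (E + 2)) + E + Ch * (4 * (E + 2)) + k + 3))%N.
Proof.
move=> X3 DX gX cX hF l n lT nT cn tr y Ky; apply/negP => /eqP y2.
(* [A + B * 2 ^ (N / 2)] dominates the exponent of [X] in the height bound; the summand [E] of [A]
   serves the lower bound on the critical orbit. The threshold on [n] makes [2 ^ m] larger, where
   [b_N] is the [k]-th iterate of [b_(m+2)]. *)
set A := (C0 + Ch * (1 + 2 ^ k * (E + 2)) + E)%N in nT.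
set B := (Ch * (4 * (E + 2)))%N in nT.
set N := n.+1.
pose m := (N - k - 2)%N.
have DN : N = (m + 2 + k)%N by rewrite /m /N; lia.
have big : (A + B * 2 ^ N./2 < 2 ^ m)%N.
  have : (N./2 + (A + B) <= m)%N.
    by have := odd_double_half N; rewrite -addnn /m; rewrite /N; lia.
  move/(leq_pexp2l (isT : 0 < 2)%N); apply: leq_trans; rewrite expnD.
  have := ltn_expl (A + B) (isT : 1 < 2)%N; have : (0 < 2 ^ N./2)%N by rewrite expn_gt0.
  by move: (2 ^ _)%N (2 ^ _)%N => u v; nia.
have crit_lower q : (E <= 2 ^ q)%N -> (X ^ (2 ^ q) <= `|crit g c q.+2|)%N.
  exact: absz_crit_lower.
have Em : (E <= 2 ^ m)%N by rewrite /A in big; lia.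
have bN0 : crit g c N != 0.
  have : (X ^ (2 ^ (m + k)) <= `|crit g c (m + k).+2|)%N.
    by apply: crit_lower; apply: leq_trans Em _; rewrite leq_pexp2l ?leq_addr.
  have -> : (m + k).+2 = N by rewrite DN; lia.
  rewrite -absz_gt0; apply: leq_trans; rewrite expn_gt0; lia.
(* If 0 were a label of level [j], transitivity would make all labels of that level 0, since
   automorphisms fix 0; but siblings are distinct. *)
have o0 j : (0 < j <= n)%N -> iter j (quadmap g c) 0 != 0.
  move=> /andP[j0 jn]; apply/negP => /eqP oj.
  have [w sw lw] : exists2 w, size w = j & 0 = l w.
    apply/(tree_preimageP lT); move: (rmorph_iter_quadmap (intr : {rmorphism int -> algC}) g c j 0).
    by rewrite oj !rmorph0 => <-.
  have all0 u : size u = j -> l u = 0.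
    by move=> su; have [nu <-] := tr j jn w u sw su; rewrite -lw rmorph0.
  case: w sw lw => [|b w] sw _; first by rewrite -sw in j0.
  have := sibling_neq lT (w := w); rewrite (_ : (size w).+1 = j) // => /(_ (cn j _)).
  by rewrite j0 jn !all0 ?eqxx => [/(_ isT)||].
have D0 : primitive_bound g c N != 0%N.
  rewrite /primitive_bound muln_eq0 /= -lt0n big_nat.
  apply: prodn_cond_gt0 => j /andP[j1 jN].
  have jn : (0 < j <= n)%N by rewrite j1 /=; have := odd_double_half N; rewrite -addnn /N; lia.
  by rewrite muln_gt0 !absz_gt0 cn ?o0.
have [d [z [Dm dD]]] : exists d z, `|crit g c N|%N = (d * z ^ 2)%N /\ (d %| primitive_bound g c N)%N.
  have [||d [z [h1 h2]]] := @squarefree_part `|crit g c N| (primitive_bound g c N).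
  - by rewrite absz_gt0.
  - move=> p pp op; have [->|p2] := eqVneq p 2%N; first exact: dvdn_mulr.
    have oddp : odd p by have [/eqP|//] := even_prime pp; rewrite (negbTE p2).
    apply: primitive_bound_dvd => //; last first.
      by have := odd_gt0 op; rewrite logn_gt0 mem_primes => /and3P[].
    apply: contrapT => h.
    have := tree_field_sqr_even lT pp oddp _ Ky y2 bN0; rewrite op; case/(_ _)/negP => //.
    move=> j /andP[j0 jn]; apply/negP => pj; apply: h; exists j => //.
    by rewrite j0 ltnS.
  by exists d, z.
(* [D] is [d] with the sign of the critical value. *)
pose D : int := (-1) ^+ (crit g c N < 0)%R * d%:Z.
have Db : D * z%:Z ^+ 2 = crit g c N.
  by rewrite [RHS]intEsign Dm /D PoszM -mulrA.
have Dabs : (`|D| <= X ^ (1 + 4 * 2 ^ N./2 * (E + 2)))%N.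
  rewrite /D abszMsign absz_nat; apply: leq_trans (primitive_bound_le N X3 gX cX).
  by apply: dvdn_leq => //; rewrite lt0n.
have Dnz : D != 0 by apply: contra bN0 => /eqP D00; rewrite -Db D00 mul0r.
pose F : {poly int} := D *: iterate (quad g c) k.
have mapF : map_poly intr F = D%:~R *: iterate (qpoly g c) k :> {poly rat}.
  by rewrite map_polyZ /= map_iterate.
have sizeQ : size (iterate (qpoly g c) k) = (2 ^ k).+1.
  rewrite -(size_map_poly (ratr : {rmorphism rat -> algC})) (map_iterate_prod lT).
  by rewrite size_prod_XsubC size_words.
have D0Q : D%:~R != 0 :> rat by rewrite intr_eq0.
have sizeF : size F = (2 ^ k).+1.
  rewrite -(size_map_inj_poly (f := intr : int -> rat)) ?mapF ?size_scale //.
  exact: intr_inj.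
have ck : crit_nz g c k.
  by move=> j /andP[j0 jk]; apply: cn; rewrite j0; lia.
have discF : disc (map_poly intr F : {poly rat}) != 0.
  rewrite mapF; apply: disc_scale_neq0 => //; last exact: (crit_nz_separable lT).
  by rewrite -size_poly_eq0 sizeQ.
pose H := (X ^ (1 + 4 * 2 ^ N./2 * (E + 2) + 2 ^ k * (E + 2)))%N.
have H0 : (0 < H)%N by rewrite expn_gt0; lia.
have coefF i : (`|(F`_i)%R| <= H)%N.
  rewrite coefZ abszM /H expnD; apply: leq_mul => //.
  apply: leq_trans (coef_iterate_quad _ _ _ _) _.
  apply: leq_trans (qmaj_iter X3 gX cX k _) _; first by rewrite expn_gt0; lia.
  by rewrite leq_pexp2l ?leq_subr //; lia.
(* Multiplying [D * z ^+ 2 = b_N] by [D] gives a point on the curve, with abscissa [b_(m+2)]. *)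
have pt : (D * z%:Z) ^+ 2 = F.[crit g c m.+2].
  rewrite hornerZ horner_iterate_quad exprMn expr2 -mulrA Db; congr (_ * _).
  by have -> : N = (k + m.+2)%N by [rewrite DN; lia]; rewrite /crit iterD.
have := hF F sizeF discF H H0 coefF _ _ pt.
apply/negP; rewrite -ltnNge; apply: leq_trans (crit_lower m Em).
have X2C : (2 ^ C0 <= X ^ C0)%N by case: (C0) => // C; rewrite leq_exp2r //; lia.
apply: (@leq_ltn_trans (X ^ (C0 + (1 + 4 * 2 ^ N./2 * (E + 2) + 2 ^ k * (E + 2)) * Ch))%N).
  by rewrite expnD expnM leq_mul.
rewrite ltn_exp2l; last by lia.
by apply: leq_ltn_trans big; rewrite /A /B; nia.
Qed.

(** * The exceptional set *)

Lemma computes1 f h v x y :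
  computes h v x -> computes f [:: x] y -> computes (RComp f [:: h]) v y.
Proof. by move=> hx fy; apply: CComp fy; do !econstructor. Qed.

Lemma computes2 f h1 h2 v x1 x2 y :
  computes h1 v x1 -> computes h2 v x2 -> computes f [:: x1; x2] y ->
  computes (RComp f [:: h1; h2]) v y.
Proof. by move=> hx1 hx2 fy; apply: CComp fy; do !(econstructor; eauto). Qed.

Lemma computes_proj i v x : (i < size v)%N -> nth 0%N v i = x -> computes (RProj i) v x.
Proof. by move=> iv <-; apply: CProj. Qed.

Definition rplus : recfun := RPrim (RProj 0) (RComp RSucc [:: RProj 1]).

Lemma computes_plus n m : computes rplus [:: n; m] (n + m).
Proof.
elim: n => [|n IHn]; first by apply/CPrim0/computes_proj.
by rewrite addSn; apply: CPrimS IHn _; apply: computes1 (CSucc _ _); apply: computes_proj.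
Qed.

Definition radd (e1 e2 : recfun) : recfun := RComp rplus [:: e1; e2].

Lemma computes_add e1 e2 v x1 x2 :
  computes e1 v x1 -> computes e2 v x2 -> computes (radd e1 e2) v (x1 + x2).
Proof. by move=> h1 h2; apply: computes2 h1 h2 (computes_plus _ _). Qed.

Lemma computes_succ e v x : computes e v x -> computes (RComp RSucc [:: e]) v x.+1.
Proof. by move=> h; apply: computes1 h (CSucc _ _). Qed.

Definition rmult : recfun := RPrim RZero (radd (RProj 1) (RProj 2)).

Lemma computes_mult n m : computes rmult [:: n; m] (n * m).
Proof.
elim: n => [|n IHn]; first exact/CPrim0/CZero.
by rewrite mulSn addnC; apply: CPrimS IHn _; apply: computes_add; apply: computes_proj.
Qed.

Definition rpow2 : recfun :=
  RPrim (RComp RSucc [:: RZero]) (radd (RProj 1) (RProj 1)).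

Lemma computes_pow2 n : computes rpow2 [:: n] (2 ^ n).
Proof.
elim: n => [|n IHn]; first exact/CPrim0/computes_succ/CZero.
by rewrite expnS mul2n -addnn; apply: CPrimS IHn _; apply: computes_add; apply: computes_proj.
Qed.

(** Primitive recursion along [countdown], each step computing [2 ^ n * (2 x + 1)], the code of a
    list with head [n] and tail of code [x]. *)
Definition rlow : recfun :=
  RPrim RZero (RComp rmult [:: RComp rpow2 [:: RProj 0];
                               RComp RSucc [:: radd (RProj 1) (RProj 1)]]).

Fixpoint countdown (n : nat) : seq nat := if n is m.+1 then m :: countdown m else [::].

Lemma mem_countdown n i : (i \in countdown n) = (i < n)%N.
Proof. by elim: n => //= n IHn; rewrite inE IHn ltnS [RHS]leq_eqVlt. Qed.

Lemma computes_low n : computes rlow [:: n] (CodeSeq.code (countdown n)).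
Proof.
elim: n => [|n IHn]; first exact/CPrim0/CZero.
apply: CPrimS IHn _ => /=; apply: computes2 (computes_mult _ _).
  by apply: computes1 (computes_pow2 _); apply: computes_proj.
by rewrite -addnn; apply: computes_succ; apply: computes_add; apply: computes_proj.
Qed.

Definition int_decode (n : nat) : int := if odd n then Negz n./2 else Posz n./2.

Lemma int_decodeK : cancel int_decode int_code.
Proof.
move=> n; rewrite /int_decode; case: ifP => on /=; have := odd_double_half n;
  by rewrite on.
Qed.

Lemma int_codeK : cancel int_code int_decode.
Proof.
by case=> n /=; rewrite /int_decode /= odd_double /= ?uphalf_double ?doubleK.
Qed.

Definition low_ints (n : nat) : seq int := map int_decode (countdown n).

Lemma ints_code_low n : ints_code (low_ints n) = CodeSeq.code (countdown n).
Proof. by rewrite /ints_code /low_ints (mapK int_decodeK). Qed.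

Lemma notin_low_ints n a : a \notin low_ints n -> (n <= 2 * `|a|)%N.
Proof.
move=> h; have : (n <= int_code a)%N.
  rewrite leqNgt; apply: contra h => an; rewrite -[a]int_codeK map_f //.
  by rewrite mem_countdown.
by case: a {h} => m /=; lia.
Qed.

(** The code itself bounds the coefficients, so the exceptional set is computed from the codes
    arithmetically, without decoding the polynomials. *)
Lemma sum_le_ints_code (s : seq int) : (\sum_(z <- s) `|z| <= ints_code s)%N.
Proof.
rewrite /ints_code; elim: s => [|z s IHs]; first by rewrite big_nil.
rewrite big_cons /=; have hz : (`|z| <= int_code z)%N by case: (z) => m /=; lia.
have : (int_code z < 2 ^ int_code z)%N by apply: ltn_expl.
by move: IHs; set A := CodeSeq.code _; move: (2 ^ _)%N => P; nia.
Qed.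

(** With [S = x + y] this is [4 S + 12], so that the remaining integers satisfy [|a| >= 2 S + 6];
    the successors mirror the program. *)
Definition exceptional_size (x y : nat) : nat := iter 12 S (4 * (x + y))%N.

Definition exceptional : recfun :=
  let s := radd (RProj 0) (RProj 1) in let d := radd s s in
  RComp rlow [:: iter 12 (fun e => RComp RSucc [:: e]) (radd d d)].

Lemma computes_exceptional x y :
  computes exceptional [:: x; y] (ints_code (low_ints (exceptional_size x y))).
Proof.
rewrite ints_code_low; apply: computes1 (computes_low _).
set d := radd (radd (RProj 0) (RProj 1)) _.
have h : computes (radd d d) [:: x; y] (4 * (x + y)).
  have -> : (4 * (x + y) = (x + y + (x + y)) + (x + y + (x + y)))%N by lia.
  by do !apply: computes_add; apply: computes_proj.
by rewrite /exceptional_size; do 12!apply: computes_succ.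
Qed.

(** * Values of integer polynomials at large integers *)

Lemma absz_leD (x y : int) : (`|(x + y)%R| <= `|x| + `|y|)%N.
Proof. by lia. Qed.

Lemma absz_geD (x y : int) : (`|y| - `|x| <= `|(x + y)%R|)%N.
Proof. by lia. Qed.

Lemma absz_horner_le (p : {poly int}) (a : int) (S : nat) :
  (\sum_(z <- p) `|z| <= S)%N -> (0 < `|a|)%N -> (S <= `|a|)%N ->
  (`|p.[a]| <= `|a| ^ (size p).+1)%N.
Proof.
move=> pS a0 Sa; rewrite horner_coef.
apply: (@leq_trans (\sum_(z <- p) `|z| * `|a| ^ size p)%N).
  rewrite (big_nth 0) big_mkord; elim/big_rec2: _ => // i x y _ xy.
  apply: leq_trans (absz_leD _ _) _.
  rewrite abszM abszX; apply: leq_add => //; rewrite leq_mul //.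
  by rewrite leq_pexp2l // ltnW.
by rewrite -big_distrl /= expnS leq_mul // (leq_trans pS).
Qed.

(** With [m + 1] the degree and [t] the sum of the lower coefficients in absolute value, the value
    is at least [|a|^m (|a| - t)]. *)
Lemma absz_horner_ge (p : {poly int}) (a : int) (S : nat) :
  (1 < size p)%N -> (\sum_(z <- p) `|z| <= S)%N -> (S < `|a|)%N ->
  (`|a| - S <= `|p.[a]|)%N.
Proof.
move=> sp pS Sa; rewrite horner_coef.
have [m Dm] : exists m, size p = m.+2 by case: (size p) sp => [|[|m]] // _; exists m.
move: pS; rewrite (big_nth 0) big_mkord Dm !big_ord_recr /=.
set Q := `|a|%N in Sa *.
have lead : (0 < `|(p`_m.+1)%R|)%N.
  by rewrite absz_gt0 -[m.+1]/(m.+2.-1) -Dm -lead_coefE lead_coef_eq0 -size_poly_gt0 ltnW.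
set t := (\sum_(i < m) `|_| + _)%N; set u := (_ + _ * a ^+ m : int).
move=> tS.
have hu : (`|u| <= t * Q ^ m)%N.
  rewrite /u /t mulnDl; apply: leq_trans (absz_leD _ _) _.
  rewrite abszM abszX leq_add2r big_distrl /=.
  elim/big_rec2: _ => // i x y _ xy.
  apply: leq_trans (absz_leD _ _) _.
  rewrite abszM abszX; apply: leq_add => //; rewrite leq_mul // leq_pexp2l //; first by lia.
  exact: ltnW.
have hv : (Q ^ m.+1 <= `|(p`_m.+1 * a ^+ m.+1)%R|)%N.
  by rewrite abszM abszX leq_pmull.
apply: (@leq_trans (Q ^ m.+1 - t * Q ^ m)%N); last first.
  by apply: leq_trans (absz_geD _ _); apply: leq_sub.
rewrite expnS -mulnBl; apply: (@leq_trans (Q - t)%N); first by lia.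
by rewrite leq_pmulr // expn_gt0; lia.
Qed.

Lemma sum_absz_widen (p : {poly int}) n : (size p <= n)%N ->
  (\sum_(z <- p) `|z| = \sum_(i < n) `|(p`_i)%R|)%N.
Proof.
move=> pn; rewrite (big_nth 0) big_mkord (big_ord_widen n (fun i => `|(p`_i)%R|%N) pn).
rewrite big_mkcond; apply: eq_bigr => i _.
by case: ltnP => // /(nth_default 0) ->.
Qed.

Lemma sum_absz_sub (p q : {poly int}) :
  (\sum_(z <- (p - q)%R) `|z| <= \sum_(z <- p) `|z| + \sum_(z <- q) `|z|)%N.
Proof.
set n := maxn (size p) (size q).
have pqn : (size (p - q)%R <= n)%N by rewrite (leq_trans (size_polyD _ _)) ?size_polyN.
rewrite (sum_absz_widen pqn) (@sum_absz_widen p n) ?leq_maxl //.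
rewrite (@sum_absz_widen q n) ?leq_maxr // -big_split /=; apply: leq_sum => i _.
by rewrite coefB; apply: leq_trans (absz_leD _ _) _; rewrite abszN.
Qed.

(** Here [X] is at least [|a| - S], hence at least half of [|a|], so [|a| <= X ^ 2]; this is why [E]
    doubles the exponents of the polynomial bounds. *)
Lemma specialization_growth (gamma c : {poly int}) (a : int) :
  (1 < size (c - gamma)%R)%N ->
  a \notin low_ints (exceptional_size (ints_code gamma) (ints_code c)) ->
  let X := `|c.[a] - gamma.[a]|%N in
  let E := (2 * (size gamma + size c + 1))%N in
  [/\ (3 <= X)%N, (`|gamma.[a]| <= X ^ E)%N & (`|c.[a]| <= X ^ E)%N].
Proof.
move=> sd aF X E; have := notin_low_ints aF; rewrite /exceptional_size.
set S := (ints_code gamma + ints_code c)%N => ha.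
have {ha} aS : (2 * S + 6 <= `|a|)%N by move: ha; move: S => T /=; lia.
have Sg : (\sum_(z <- gamma) `|z| <= S)%N.
  by apply: leq_trans (sum_le_ints_code _) _; apply: leq_addr.
have Sc : (\sum_(z <- c) `|z| <= S)%N.
  by apply: leq_trans (sum_le_ints_code _) _; apply: leq_addl.
have Sd : (\sum_(z <- (c - gamma)%R) `|z| <= S)%N.
  apply: leq_trans (sum_absz_sub _ _) _; rewrite addnC.
  by apply: leq_add; apply: sum_le_ints_code.
have aX : (`|a| - S <= X)%N.
  rewrite /X -hornerN -hornerD; apply: absz_horner_ge => //.
  by apply: leq_trans aS; lia.
have X3 : (3 <= X)%N by apply: leq_trans aX; lia.
have aX2 : (`|a| <= X ^ 2)%N by rewrite -mulnn; nia.
have small (p : {poly int}) : (\sum_(z <- p) `|z| <= S)%N ->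
    ((size p).+1 * 2 <= E)%N -> (`|p.[a]| <= X ^ E)%N.
  move=> pS pE; apply: leq_trans (absz_horner_le pS _ _) _; try lia.
  apply: (@leq_trans (X ^ ((size p).+1 * 2))%N).
    by rewrite mulnC expnM leq_exp2r.
  by rewrite leq_pexp2l //; lia.
by split=> //; apply: small => //; rewrite /E; lia.
Qed.

Theorem theorem1 (R : realType)
    (hB : (height_bound R 3 /\ height_bound R 4) \/
          (forall d : nat, (5 <= d)%N -> height_bound R d)) :
  exists algo : recfun,
  forall gamma c : {poly int},
    let phi : {poly {poly int}} := quad gamma c in
    ~ isotrivial gamma c ->
    phi.[gamma] * (iterate phi 2).[gamma] != 0 ->
    exists (n_phi : nat) (F_phi : seq int),
      [/\ (0 < n_phi)%N,
          computes algo [:: ints_code gamma; ints_code c] (ints_code F_phi),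
          (forall a : int, a \notin F_phi ->
             galois_full (spec gamma c a) n_phi ->
             galois_full_infty (spec gamma c a)) &
          exists M : nat, forall a : int, a \notin F_phi ->
             stable (spec gamma c a) ->
             galois_index_le (spec gamma c a) M].
Proof.
have [k [Ch [C0 hk]]] : exists k Ch C0, int_point_bound k Ch C0.
  (* The curves have degree 4 under Hall--Lang and degree 8 under Vojta. *)
  case: hB => [[_ h4]|h].
    by exists 2%N; apply: (@height_bound_int R).
  by exists 3%N; apply: (@height_bound_int R); apply: h.
exists exceptional => gamma c phi nonisotrivial _.
have sd : (1 < size (c - gamma)%R)%N by rewrite ltnNge; apply/negP.
set F := low_ints (exceptional_size (ints_code gamma) (ints_code c)).
set E := (2 * (size gamma + size c + 1))%N.
(* This level depends on the height constants and the sizes of the two polynomials, not on [a];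
   hence so does the index bound, the number of self-maps of level [n0]. *)
set n0 := (2 * (C0 + Ch * (1 + 2 ^ k * (E + 2)) + E + Ch * (4 * (E + 2)) + k + 3))%N.
have n0_gt0 : (0 < n0)%N by rewrite /n0; lia.
have ns a : a \notin F -> nonsquare_from gamma.[a] c.[a] n0.
  move=> aF; have [X3 gX cX] := specialization_growth sd aF.
  exact: nonsquare_of_bound X3 erefl gX cX hk.
exists n0, F; split=> //.
- exact: computes_exceptional.
- by move=> a /ns hns; apply: full_of_level.
- by eexists => a /ns hns st; apply: (index_of_stable n0_gt0 hns st).
Qed.
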